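(* Let $p\ge1$, $m=2p$, $N\ge0$, and let $\beta(0),\dots,\beta(N)$ be $p\times m$ matrices with $\beta(k)J\beta(k)^*=I_p$. Put $C_k=2K^*\beta(k)^*\beta(k)K-j$ ($0\le k\le N$), let $W_k(\lambda)$ be the solution of $W_{k+1}(\lambda)-W_k(\lambda)=-\frac{i}{\lambda}jC_kW_k(\lambda)$ with $W_0=I_m$, and let $\mathcal W(\lambda)=\{\mathcal W_{ij}(\lambda)\}_{i,j=1}^2=KW_{N+1}(\bar\lambda)^*$ (blocks of size $p\times p$). Let $R,Q$ be $p\times p$ matrix functions analytic in a neighbourhood of $\lambda=-i$ with $\det\big(\mathcal W_{11}(-i)R(-i)+\mathcal W_{12}(-i)Q(-i)\big)\neq0$, and put $$\varphi(\lambda)=i\big(\mathcal W_{21}(\lambda)R(\lambda)+\mathcal W_{22}(\lambda)Q(\lambda)\big)\big(\mathcal W_{11}(\lambda)R(\lambda)+\mathcal W_{12}(\lambda)Q(\lambda)\big)^{-1}.$$ Then: $C_k=C_k^*$, $C_kjC_k=j$ and $C_k>0$ for $0\le k\le N$; $\det(\beta(k)J\beta(k+1)^* )\neq0$ for $0\le k\le N-1$; and the matrices $C_0,\dots,C_N$ are uniquely determined by the first $N+1$ Taylor coefficients $\alpha_0,\dots,\alpha_N$ at $z=0$ of $i\varphi\big(i\frac{z+1}{z-1}\big)$, as follows. Let $\Phi_1$ be the $(N+1)p\times p$ block column with all blocks $I_p$, $\Phi_2$ the block column with blocks $\alpha_0,\ \alpha_0+\alpha_1,\ \dots,\ \alpha_0+\alpha_1+\dots+\alpha_N$,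 $\Pi=[\Phi_1\ \ \Phi_2]$, and $A=\{a_{j-k}\}_{k,j=0}^N$ the $(N+1)p\times(N+1)p$ block matrix with $a_r=0$ for $r>0$, $a_0=\frac i2I_p$, $a_r=iI_p$ for $r<0$. Then the matrix identity $AS-SA^*=i\Pi J\Pi^*$ has a unique solution $S$, this $S$ is positive definite, and $$\Pi^*S^{-1}\Pi=B^*B=\sum_{k=0}^N\beta(k)^*\beta(k),\qquad B=\begin{bmatrix}\beta(0)\\ \vdots\\ \beta(N)\end{bmatrix}.$$
   Context: $j=\mathrm{diag}(I_p,-I_p)$, $J=\begin{bmatrix}0&I_p\\ I_p&0\end{bmatrix}$, $K=\frac1{\sqrt2}\begin{bmatrix}I_p&-I_p\\ I_p&I_p\end{bmatrix}$ (so $K^*=K^{-1}$, $KjK^*=J$); $I_p$ is the $p\times p$ identity matrix. *)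

(* Defs.v *)
(* complex numbers C := R[i] over an arbitrary realType R
   (complete real field), block matrices from mathcomp's matrix.v. *)
From mathcomp Require Import all_boot all_order all_algebra.
From mathcomp Require Import reals complex.
Set Implicit Arguments. Unset Strict Implicit. Unset Printing Implicit Defensive.
Import Order.TTheory GRing.Theory Num.Theory.
Local Open Scope ring_scope.

Section Defs.
Context {R : realType}.
Local Notation C := R[i].

(* conjugate transpose A^* *)
Definition adj m n (A : 'M[C]_(m, n)) : 'M[C]_(n, m) := (map_mx Num.conj A)^T.

(* positive definite: Hermitian with positive quadratic form on nonzero vectors *)
Definition posdef n (A : 'M[C]_n) : Prop :=
  adj A = A /\ forall v : 'cV[C]_n, v != 0 -> 0 < (adj v *m A *m v) 0 0.

(* j = diag(I_p, -I_p), J = [0 I; I 0], K = 1/sqrt2 [I -I; I I] *)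
Definition jmx p : 'M[C]_(p + p) := block_mx 1%:M 0 0 (- 1%:M).
Definition Jmx p : 'M[C]_(p + p) := block_mx 0 1%:M 1%:M 0.
Definition Kmx p : 'M[C]_(p + p) :=
  (2.-root (2 : C))^-1 *: block_mx 1%:M (- 1%:M) 1%:M 1%:M.

(* C_k = 2 K^* beta(k)^* beta(k) K - j *)
Definition Cmx p (beta : nat -> 'M[C]_(p, p + p)) (k : nat) : 'M[C]_(p + p) :=
  2 *: (adj (Kmx p) *m adj (beta k) *m beta k *m Kmx p) - jmx p.

(* W_0 = I,  W_{k+1}(l) = W_k(l) - (i/l) j C_k W_k(l) *)
Fixpoint Wmx p (beta : nat -> 'M[C]_(p, p + p)) (k : nat) (l : C)
    : 'M[C]_(p + p) :=
  match k with
  | 0 => 1%:M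
  | k'.+1 => Wmx beta k' l - ('i / l) *: (jmx p *m Cmx beta k' *m Wmx beta k' l)
  end.

(* calW(l) = K W_{N+1}(conj l)^* *)
Definition calW p (beta : nat -> 'M[C]_(p, p + p)) (N : nat) (l : C)
    : 'M[C]_(p + p) := Kmx p *m adj (Wmx beta N.+1 (l^*)).

Definition calW11 p beta N l : 'M[C]_p := ulsubmx (@calW p beta N l).
Definition calW12 p beta N l : 'M[C]_p := ursubmx (@calW p beta N l).
Definition calW21 p beta N l : 'M[C]_p := dlsubmx (@calW p beta N l).
Definition calW22 p beta N l : 'M[C]_p := drsubmx (@calW p beta N l).

(* phi(l) = i (W21 R + W22 Q)(W11 R + W12 Q)^{-1} *)
Definition phi p (beta : nat -> 'M[C]_(p, p + p)) (N : nat)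
    (Rf Qf : C -> 'M[C]_p) (l : C) : 'M[C]_p :=
  'i *: ((calW21 beta N l *m Rf l + calW22 beta N l *m Qf l)
         *m invmx (calW11 beta N l *m Rf l + calW12 beta N l *m Qf l)).

(* the function  z |-> i phi(i (z+1)/(z-1))  *)
Definition fz p (beta : nat -> 'M[C]_(p, p + p)) (N : nat)
    (Rf Qf : C -> 'M[C]_p) (z : C) : 'M[C]_p :=
  'i *: phi beta N Rf Qf ('i * (z + 1) / (z - 1)).

(* convergence of the series sum_k a_k to s *)
Definition series_conv_to (a : nat -> C) (s : C) : Prop :=
  forall eps : C, 0 < eps ->
    exists M : nat, forall n : nat, (M <= n)%N -> `|\sum_(k < n) a k - s| < eps.

(* F(z) = sum_k c_k (z - z0)^k (entrywise convergent) on a disc around z0 *)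
Definition powser_expansion m n (z0 : C) (c : nat -> 'M[C]_(m, n))
    (F : C -> 'M[C]_(m, n)) : Prop :=
  exists r : C, 0 < r /\
    forall z : C, `|z - z0| < r ->
      forall (i : 'I_m) (j : 'I_n),
        series_conv_to (fun k => c k i j * (z - z0) ^+ k) (F z i j).

(* analytic in a neighbourhood of z0 *)
Definition analytic_at m n (F : C -> 'M[C]_(m, n)) (z0 : C) : Prop :=
  exists c : nat -> 'M[C]_(m, n), powser_expansion z0 c F.

(* standing hypotheses of the theorem, for given p, N, beta, R, Q *)
Definition admissible p N (beta : nat -> 'M[C]_(p, p + p))
    (Rf Qf : C -> 'M[C]_p) : Prop :=
  [/\ forall k, (k <= N)%N -> beta k *m Jmx p *m adj (beta k) = 1%:M,
      analytic_at Rf (- 'i), analytic_at Qf (- 'i) &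
      \det (calW11 beta N (- 'i) *m Rf (- 'i)
            + calW12 beta N (- 'i) *m Qf (- 'i)) != 0].

(* block matrices of block size p, with N+1 block rows *)
Definition Amx p N : 'M[C]_(\sum_(k < N.+1) p) :=
  @mxblock C N.+1 N.+1 (fun=> p) (fun=> p)
    (fun k l => if (k < l)%N then 0 else if k == l then ('i / 2)%:M else 'i%:M).

Definition Phi1 p N : 'M[C]_(\sum_(k < N.+1) p, p) :=
  @mxcol C N.+1 (fun=> p) p (fun _ => 1%:M).

Definition Phi2 p N (alpha : nat -> 'M[C]_p) : 'M[C]_(\sum_(k < N.+1) p, p) :=
  @mxcol C N.+1 (fun=> p) p (fun k => \sum_(r < N.+1 | (r <= k)%N) alpha r).

Definition Pimx p N alpha : 'M[C]_(\sum_(k < N.+1) p, p + p) :=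
  row_mx (Phi1 p N) (Phi2 N alpha).

Definition Bmx p N (beta : nat -> 'M[C]_(p, p + p))
    : 'M[C]_(\sum_(k < N.+1) p, p + p) :=
  @mxcol C N.+1 (fun=> p) (p + p) (fun k => beta k).

End Defs.

(* Main.v *)
(* Write p_k = beta(k)^* beta(k) J and lambda = i(z+1)/(z-1).  Up to the scalar
(2/(1+z))^(N+1), which cancels in phi, the matrix W(lambda) is E_0(z) ... E_N(z) K with E_k(z)
= 1 - (1-z) p_k.  Hence [I; -psi(z)] = E_0(z) ... E_N(z) G(z) near z = 0 with G analytic, where
psi(z) = i phi(lambda).  With Y_k = E_k ... E_N G and u_k = beta(k) J Y_(k+1), this reads
     B J [I; -psi(z)] = (z(1+L) - L) u(z),
where L is the strictly lower block triangular part of B J B^*, so that 1 + L + L^* = B J B^*.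
The subdiagonal blocks of L are invertible because C_k > 0; therefore L is similar to the
strictly lower triangular matrix L0 of ones, by an X with X L = L0 X that maps the first block
column of B to Phi_1.  Multiplying by X, the rows telescope:
     sum_(k<K) z^k ((X B_2)_k - psi(z)) = O(z^K),
which forces (X B_2)_k = alpha_0 + ... + alpha_k, that is, X B = Pi.  Then S = X X^* solves the
matrix identity and Pi^* S^-1 Pi = B^* B.  Using this for every n <= N recovers each beta(k)^*
beta(k), hence C_k. *)
Require Import Defs.
From mathcomp Require Import all_boot all_order all_algebra.
From mathcomp Require Import reals complex zify ring.
Set Implicit Arguments. Unset Strict Implicit. Unset Printing Implicit Defensive.
Import Order.TTheory GRing.Theory Num.Theory.
Local Open Scope ring_scope.

(** * Functions with a power series expansion at 0 *)

Lemma double_succ_le_exp3 n : (n * 2 + 1 <= 3 ^ n)%N.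
Proof. by elim: n => // n IH; rewrite expnS; lia. Qed.

Section Analytic.
Context {R : realType}.
Local Notation C := R[i].
Implicit Types (c d : nat -> C) (f g : C -> C) (z w : C) (B n : nat).

Lemma le_of_eq (x y : C) : x = y -> x <= y.
Proof. by move=> ->. Qed.

Lemma norm_le_nat (x : C) : exists b : nat, `|x| <= b%:R.
Proof.
exists (Num.bound (Num.sqrt (complex.Re x ^+ 2 + complex.Im x ^+ 2))).
rewrite normc_def -(rmorph_nat (real_complex R)) lecR; apply: ltW.
exact/archi_boundP/sqrtr_ge0.
Qed.

(* The constant [B] serves at once as an inverse radius and as a bound, so enlarging it only
weakens the property. *)
Definition expands c f B := forall n z, B%:R * `|z| <= 1 ->
  `|f z - \sum_(k < n) c k * z ^+ k| <= B%:R * (B%:R * `|z|) ^+ n.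

Lemma le1_mono B B' z : (B <= B')%N -> B'%:R * `|z| <= 1 -> B%:R * `|z| <= 1.
Proof. by move=> le; apply: le_trans; rewrite ler_wpM2r // ler_nat. Qed.

Lemma expands_mono B B' c f : (B <= B')%N -> expands c f B -> expands c f B'.
Proof.
move=> le H n z hz; apply: le_trans (H n z (le1_mono le hz)) _.
have leR : B%:R <= B'%:R :> C by rewrite ler_nat.
rewrite ler_pM ?exprn_ge0 ?mulr_ge0 // lerXn2r ?nnegrE ?mulr_ge0 //.
by rewrite ler_wpM2r.
Qed.

Lemma expands_bound c f B z : expands c f B -> B%:R * `|z| <= 1 -> `|f z| <= B%:R.
Proof. by move=> H /(H 0%N); rewrite big_ord0 subr0 expr0 mulr1. Qed.

(** At the point [1/B], on the rim of the disc, every remainder is at most [B], and the term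
    [c n * z ^+ n] is the difference of two consecutive remainders. *)
Lemma expands_coef c f B n : (0 < B)%N -> expands c f B ->
  `|c n| <= 2 * B%:R * B%:R ^+ n.
Proof.
move=> B0 H.
have BR0 : 0 < B%:R :> C by rewrite ltr0n.
have nz : B%:R * `|B%:R^-1 : C| = 1 by rewrite normfV gtr0_norm ?divff ?gt_eqF.
have /= H1 := H n B%:R^-1; have /= H2 := H n.+1 B%:R^-1.
move: H1 H2; rewrite nz !expr1n mulr1 lexx big_ord_recr /= => /(_ isT) H1 /(_ isT) H2.
have := ler_normB (f B%:R^-1 - \sum_(k < n) c k * B%:R^-1 ^+ k)
  (f B%:R^-1 - (\sum_(k < n) c k * B%:R^-1 ^+ k + c n * B%:R^-1 ^+ n)).
have -> : forall a b d : C, a - b - (a - (b + d)) = d by move=> a b d; ring.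
rewrite normrM normrX normfV (gtr0_norm BR0) => h.
rewrite -ler_pdivrMr ?exprn_gt0 // -exprVn; apply: le_trans h _.
by rewrite mulr_natl mulr2n lerD.
Qed.

Lemma expands_eq c f g B B' : (forall z, B'%:R * `|z| <= 1 -> f z = g z) ->
  expands c f B -> expands c g (maxn B B').
Proof.
move=> fg /(expands_mono (leq_maxl B B')) H n z hz.
by rewrite -fg ?H // (le1_mono (leq_maxr B B')).
Qed.

Definition conv c d n : C := \sum_(i < n.+1) c i * d (n - i)%N.

Lemma conv_sum c d z n : \sum_(k < n) conv c d k * z ^+ k =
  \sum_(i < n) c i * z ^+ i * \sum_(m < n - i) d m * z ^+ m.
Proof.
elim: n => [|n IHn]; first by rewrite !big_ord0.
rewrite big_ord_recr {}IHn [RHS]big_ord_recr /= subSnn big_ord1 expr0 mulr1.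
rewrite {1}/conv big_ord_recr /= subnn mulrDl addrA; congr (_ + _); last by ring.
rewrite mulr_suml -big_split; apply: eq_bigr => i _ /=.
have le_in : (i <= n)%N by exact: ltnW.
rewrite (subSn le_in) [in RHS]big_ord_recr [RHS]mulrDr; congr (_ + _).
have -> : z ^+ n = z ^+ i * z ^+ (n - i) by rewrite -exprD subnKC.
by rewrite /=; ring.
Qed.

(** Splits the remainder of a product into remainders of the factors: [c i * z ^+ i] meets the
    remainder of [g] of order [n - i], so every term has order [n]. *)
Lemma conv_rem c d f g z n :
  f z * g z - \sum_(k < n) conv c d k * z ^+ k =
  \sum_(i < n) c i * z ^+ i * (g z - \sum_(m < n - i) d m * z ^+ m)
  + (f z - \sum_(i < n) c i * z ^+ i) * g z.
Proof.
rewrite conv_sum; under [X in _ = X + _]eq_bigr do rewrite mulrBr.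
by rewrite sumrB -mulr_suml; ring.
Qed.

(** With [D = B|z|] the terms of [conv_rem] add up to at most [(2n+1) B^2 D^n]; the factor 3 in the
    new inverse radius absorbs [2n+1] through [double_succ_le_exp3]. *)
Lemma expandsM c d f g B : (0 < B)%N -> expands c f B -> expands d g B ->
  expands (conv c d) (fun z => f z * g z) (3 * B ^ 2).
Proof.
move=> B0 Hf Hg n z hz.
have le : (B <= 3 * B ^ 2)%N by rewrite expnS expn1 mulnA leq_pmull // muln_gt0.
have hB := le1_mono le hz.
rewrite conv_rem; set D := B%:R * `|z|.
have D0 : 0 <= D by rewrite mulr_ge0.
have h1 : `|\sum_(i < n) c i * z ^+ i * (g z - \sum_(m < n - i) d m * z ^+ m)|
   <= (n * 2 * B ^ 2)%:R * D ^+ n.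
  apply: le_trans (ler_norm_sum _ _ _) _.
  apply: le_trans (_ : \sum_(i < n) (2 * B ^ 2)%:R * D ^+ n <= _); last first.
    by rewrite sumr_const card_ord -mulrnAl -mulrnA mulnC mulnA.
  apply: ler_sum => i _; rewrite !normrM normrX.
  apply: le_trans (_ : (2 * B%:R * B%:R ^+ i) * `|z| ^+ i * (B%:R * D ^+ (n - i)) <= _).
    rewrite ler_pM ?mulr_ge0 ?exprn_ge0 //; last exact: Hg.
    by rewrite ler_wpM2r ?exprn_ge0 //; apply: expands_coef Hf.
  have -> : D ^+ n = D ^+ (n - i) * (B%:R ^+ i * `|z| ^+ i).
    by rewrite -exprMn -exprD subnK // ltnW.
  rewrite natrM natrX.
  by apply: le_of_eq; ring.
have h2 : `|(f z - \sum_(i < n) c i * z ^+ i) * g z| <= (B ^ 2)%:R * D ^+ n.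
  rewrite normrM; apply: le_trans (ler_pM _ _ (Hf n z hB) (expands_bound Hg hB)) _ => //.
  by rewrite natrX -/D mulrAC -expr2.
apply: le_trans (ler_normD _ _) _; apply: le_trans (lerD h1 h2) _.
rewrite -mulrDl -natrD.
have -> : (3 * B ^ 2)%:R * `|z| = (3 * B)%:R * D.
  by rewrite /D !natrM; ring.
rewrite [((3 * B)%:R * D) ^+ n]exprMn -natrX mulrA -natrM.
rewrite ler_wpM2r ?exprn_ge0 // ler_nat.
have h3 := double_succ_le_exp3 n.
have h4 : (0 < B ^ n)%N by rewrite expn_gt0 B0.
rewrite expnMn -{2}[(B ^ 2)%N]mul1n -mulnDl mulnAC leq_mul //.
apply: leq_trans (_ : 3 * 3 ^ n <= _)%N; last by rewrite leq_mul // leq_pmulr.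
by rewrite (leq_trans h3) // leq_pmull.
Qed.

Lemma expandsD c d f g B : expands c f B -> expands d g B ->
  expands (fun k => c k + d k) (fun z => f z + g z) (2 * B).
Proof.
move=> Hf Hg n z hz.
have hB := le1_mono (leq_pmull B (isT : 0 < 2)%N) hz.
under eq_bigr do rewrite mulrDl.
rewrite big_split /= opprD addrACA.
apply: le_trans (ler_normD _ _) _; apply: le_trans (lerD (Hf n z hB) (Hg n z hB)) _.
rewrite -mulrDl -natrD addnn -mul2n ler_wpM2l //.
by rewrite lerXn2r ?nnegrE ?mulr_ge0 // ler_wpM2r // ler_nat leq_pmull.
Qed.

Lemma expands_cst (a : C) B : `|a| <= B%:R ->
  expands (fun k => if k is 0%N then a else 0) (fun=> a) B.
Proof.
move=> ha [|n] z hz; first by rewrite big_ord0 subr0 expr0 mulr1.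
rewrite big_ord_recl big1 => [|i _]; last by rewrite mul0r.
by rewrite expr0 mulr1 addr0 subrr normr0 mulr_ge0 ?exprn_ge0 ?mulr_ge0.
Qed.

Lemma expands_id : expands (fun k => (k == 1%N)%:R : C) id 1.
Proof.
move=> [|[|n]] z; rewrite mul1r => hz.
- by rewrite big_ord0 subr0 expr0 mulr1.
- by rewrite big_ord1 /= mul0r subr0 mul1r.
rewrite 2!big_ord_recl big1 => [|i _]; last by rewrite mul0r.
by rewrite /= mul0r add0r mul1r expr1 addr0 subrr normr0 mulr_ge0 ?exprn_ge0.
Qed.

Lemma expands_geom : expands (fun=> 1 : C) (fun z => (1 - z)^-1) 2.
Proof.
move=> n z hz.
have z2 : `|z| <= 2^-1 by rewrite -[2^-1]mulr1 ler_pdivlMl.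
have h : 2^-1 <= `|1 - z|.
  have := lerB_dist 1 z; rewrite normr1; apply: le_trans.
  rewrite lerBrDl -lerBrDr; apply: le_trans z2 _.
  by apply: le_of_eq; field.
have h0 : 0 < `|1 - z| by apply: lt_le_trans h; rewrite invr_gt0.
have n0 : 1 - z != 0 by rewrite -normr_gt0.
under eq_bigr do rewrite mul1r.
have -> : (1 - z)^-1 - \sum_(k < n) z ^+ k = z ^+ n / (1 - z).
  have := subrX1 z n; set S := \sum_(k < n) _ => e.
  have -> : z ^+ n = 1 - (1 - z) * S by rewrite -[z ^+ n](subrK 1) e; ring.
  by field.
rewrite normrM normfV normrX mulrC ler_pM ?invr_ge0 ?exprn_ge0 //.
  by rewrite -[leRHS]invrK lef_pV2 ?posrE ?invr_gt0.
by rewrite lerXn2r ?nnegrE ?mulr_ge0 // ler_peMl // ler1n.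
Qed.

(** Taylor coefficients of the [k]-th power of the function with coefficients [d]. *)
Fixpoint cpow d k : nat -> C :=
  if k is k'.+1 then conv d (cpow d k') else fun n => (n == 0%N)%:R.

(** Each factor without constant term raises the order of vanishing by one. This is what makes every
    coefficient of a composite a finite sum. *)
Lemma cpow_small d k n : d 0%N = 0 -> (n < k)%N -> cpow d k n = 0.
Proof.
move=> d0; elim: k n => [|k IHk] n // nk /=.
rewrite /conv big1 // => -[[|i] /= hi] _; first by rewrite d0 mul0r.
by rewrite IHk ?mulr0 //; lia.
Qed.

(* The bound is uniform in [k], which is what the composition lemma needs. *)
Lemma expands_pow d g B : (0 < B)%N -> d 0%N = 0 -> expands d g B ->
  forall k n z, (B * (2 * B + 1))%:R * `|z| <= 1 ->
  `|g z ^+ k - \sum_(m < n) cpow d k m * z ^+ m|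
     <= ((B * (2 * B + 1))%:R * `|z|) ^+ n.
Proof.
move=> B0 d0 Hg; set B' := (B * (2 * B + 1))%N => k n z hz.
have leB : (B <= B')%N by rewrite leq_pmulr // addn1.
have hB := le1_mono leB hz.
have g1 : `|g z| <= 1.
  have := Hg 1%N z hB; rewrite big_ord1 d0 mul0r subr0 expr1 mulrA => h.
  apply: le_trans h (le_trans _ hz); rewrite ler_wpM2r // -natrM ler_nat.
  by rewrite leq_mul //; lia.
elim: k n => [|k IHk] n.
  rewrite expr0; case: n => [|n]; first by rewrite big_ord0 subr0 normr1 expr0.
  rewrite big_ord_recl big1 => [|i _]; last by rewrite mul0r.
  by rewrite expr0 mulr1 addr0 subrr normr0 exprn_ge0 ?mulr_ge0.
rewrite exprS (conv_rem d _ g (fun z => g z ^+ k)).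
set D := B%:R * `|z|; have D0 : 0 <= D by rewrite mulr_ge0.
have eD : B'%:R * `|z| = (2 * B + 1)%:R * D by rewrite /D /B' natrM; ring.
(* Since [s - 1 = 2B], the sum of [2B s^i] over [i <= n] is [s^(n+1) - 1]; this closes the induction
   on [k] without a growing constant. *)
pose s : C := (2 * B + 1)%:R.
case: n => [|n].
  rewrite !big_ord0 add0r subr0 expr0 normrM mulr_ile1 // normrX exprn_ile1 //.
rewrite big_ord_recl d0 !mul0r add0r.
have h1 : `|\sum_(i < n) d (lift ord0 i) * z ^+ (lift ord0 i) *
     (g z ^+ k - \sum_(m < n.+1 - lift ord0 i) cpow d k m * z ^+ m)|
   <= \sum_(i < n) 2 * B%:R * s ^+ (n - i) * D ^+ n.+1.
  apply: le_trans (ler_norm_sum _ _ _) _; apply: ler_sum => i _.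
  rewrite !normrM normrX.
  apply: le_trans (_ : (2 * B%:R * B%:R ^+ i.+1) * `|z| ^+ i.+1 * (s * D) ^+ (n - i) <= _).
    rewrite ler_pM ?mulr_ge0 ?exprn_ge0 //; last by rewrite -eD; apply: IHk.
    by rewrite ler_wpM2r ?exprn_ge0 //; apply: expands_coef Hg.
  have -> : D ^+ n.+1 = D ^+ (n - i) * (B%:R ^+ i.+1 * `|z| ^+ i.+1).
    by rewrite -exprMn -exprD addnS subnK // ltnW.
  by rewrite exprMn; apply: le_of_eq; ring.
have h2 : `|(g z - \sum_(i < n.+1) d i * z ^+ i) * g z ^+ k| <= B%:R * D ^+ n.+1.
  rewrite normrM normrX -[leRHS]mulr1 ler_pM ?exprn_ge0 ?exprn_ile1 //.
  exact: Hg.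
apply: le_trans (ler_normD _ _) _; apply: le_trans (lerD h1 h2) _.
rewrite eD -/s [(s * D) ^+ _]exprMn -mulr_suml -mulrDl ler_wpM2r ?exprn_ge0 // -mulr_sumr.
have eS : \sum_(i < n) s ^+ (n - i) = \sum_(i < n) s ^+ i.+1.
  rewrite (reindex_inj rev_ord_inj) /=; apply: eq_bigr => i _.
  by rewrite subKn.
have := subrX1 s n.+1; rewrite big_ord_recl expr0 => e.
rewrite -[leRHS](subrK 1) e eS /s natrD natrM addrK mulrDr mulr1.
rewrite addrAC [leRHS]addrC lerD2l //.
rewrite -[leLHS]addr0 lerD // mulr_natl mulr2n -[leLHS]addr0 lerD //.
Qed.

(** First [f (g z)] is compared with the partial sum of [c k * g z ^+ k], using [|g z| <= B^2 |z|];
    then each power of [g] is compared with its own Taylor polynomial by [expands_pow]. *)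
Lemma expands_comp c d f g B : (0 < B)%N -> d 0%N = 0 ->
  expands c f B -> expands d g B ->
  exists h B', expands h (fun z => f (g z)) B'.
Proof.
move=> B0 d0 Hf Hg.
set B' := (B * (2 * B + 1))%N.
(* In the inverse radius, [B ^ 3] comes from [B|g z| <= B^3 |z|], [B'] from [expands_pow], and 3
   again absorbs a factor [2n+1]. *)
exists (fun m => \sum_(k < m.+1) c k * cpow d k m), (3 * B ^ 3 * B')%N => n z hz.
have B'0 : (0 < B')%N by rewrite muln_gt0 B0 addn1.
have leB' : (B' <= 3 * B ^ 3 * B')%N by rewrite leq_pmull // muln_gt0 expn_gt0 B0.
have hB' := le1_mono leB' hz.
have leB : (B <= B')%N by rewrite leq_pmulr // addn1.
have hB := le1_mono leB hB'.
set X := B'%:R * `|z|; have X0 : 0 <= X by rewrite mulr_ge0.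
have gz : `|g z| <= B%:R ^+ 2 * `|z|.
  by have := Hg 1%N z hB; rewrite big_ord1 d0 mul0r subr0 expr1 mulrA.
have hg : B%:R * `|g z| <= (B ^ 3)%:R * `|z|.
  apply: le_trans (ler_wpM2l _ gz) _ => //.
  by rewrite natrX; apply: le_of_eq; ring.
have hg' : (B ^ 3)%:R * `|z| <= (B ^ 3)%:R * X.
  by rewrite ler_wpM2l // ler_peMl // ler1n.
have hg1 : B%:R * `|g z| <= 1.
  apply: le_trans hg (le_trans hg' (le_trans _ hz)).
  rewrite mulrA -natrM ler_wpM2r // ler_nat leq_mul // leq_pmull //.
have -> : \sum_(m < n) (\sum_(k < m.+1) c k * cpow d k m) * z ^+ m =
   \sum_(k < n) c k * \sum_(m < n) cpow d k m * z ^+ m.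
  under [RHS]eq_bigr do rewrite mulr_sumr.
  rewrite exchange_big; apply: eq_bigr => m _ /=; rewrite mulr_suml.
  rewrite (big_ord_widen n (fun k => c k * cpow d k m * z ^+ m)) // big_mkcond /=.
  apply: eq_bigr => k _; case: ltnP => [_|h]; first by rewrite mulrA.
  by rewrite cpow_small // mul0r mulr0.
rewrite -(subrKA (\sum_(k < n) c k * g z ^+ k)) -sumrB.
under [X in `|_ + X|]eq_bigr do rewrite -mulrBr.
have h1 : `|f (g z) - \sum_(k < n) c k * g z ^+ k| <= B%:R * ((B ^ 3)%:R * X) ^+ n.
  apply: le_trans (Hf n _ hg1) _; rewrite ler_wpM2l //.
  by rewrite lerXn2r ?nnegrE ?mulr_ge0 // (le_trans hg).
have h2 : `|\sum_(k < n) c k * (g z ^+ k - \sum_(m < n) cpow d k m * z ^+ m)|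
    <= (n * (2 * B * B ^ n))%:R * X ^+ n.
  apply: le_trans (ler_norm_sum _ _ _) _.
  apply: le_trans (_ : \sum_(i < n) (2 * B * B ^ n)%:R * X ^+ n <= _); last first.
    by rewrite sumr_const card_ord -mulrnAl -mulrnA mulnC.
  apply: ler_sum => i _; rewrite normrM ler_pM //; last exact: expands_pow.
  apply: le_trans (expands_coef i B0 Hf) _.
  by rewrite -natrX -!natrM ler_nat leq_mul // leq_pexp2l // ltnW.
apply: le_trans (ler_normD _ _) _; apply: le_trans (lerD h1 h2) _.
have -> : (3 * B ^ 3 * B')%:R * `|z| = (3 * B ^ 3)%:R * X.
  by rewrite /X (natrM _ (3 * B ^ 3)) mulrA.
rewrite 2![(_ * X) ^+ n]exprMn !mulrA -mulrDl.
rewrite ler_wpM2r ?exprn_ge0 // -!natrX -!natrM -natrD ler_nat.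
have h3 := double_succ_le_exp3 n.
have h4 : (B ^ n <= (B ^ 3) ^ n)%N by rewrite -expnM leq_pexp2l // leq_pmull.
have h5 : (B <= 3 * B ^ 3 * B')%N by rewrite (leq_trans leB).
rewrite expnMn; move: h4; set P := (_ ^ n)%N; set Q := ((B ^ 3) ^ n)%N => h4.
apply: leq_trans (_ : B * (3 ^ n * Q) <= _)%N; last by rewrite leq_mul.
apply: leq_trans (_ : B * ((n * 2 + 1) * Q) <= _)%N; last by rewrite leq_mul // leq_mul.
rewrite mulnDl mul1n mulnDr addnC leq_add //.
rewrite [leqLHS](_ : _ = B * (n * 2 * P))%N; first by rewrite !leq_mul.
by ring.
Qed.

(** Analyticity at 0 through remainder bounds; [series_expands] and [expands_series] translate from
    and to convergent power series. *)
Definition holo f := exists c B, expands c f B.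

Lemma holo_common f g : holo f -> holo g ->
  exists c d B, [/\ (0 < B)%N, expands c f B & expands d g B].
Proof.
move=> [c [B H]] [d [B' H']]; exists c, d, (maxn 1 (maxn B B')).
split; first by rewrite leq_maxl.
  by apply: expands_mono H; rewrite !leq_max leqnn !orbT.
by apply: expands_mono H'; rewrite !leq_max leqnn !orbT.
Qed.

Lemma holo_eq_near f g B : (forall z, B%:R * `|z| <= 1 -> f z = g z) -> holo f -> holo g.
Proof. by move=> fg [c [B' H]]; exists c, (maxn B' B); apply: expands_eq H. Qed.

Lemma holo_eq f g : f =1 g -> holo f -> holo g.
Proof. by move=> fg; apply: (@holo_eq_near _ _ 0) => z _. Qed.

Lemma holo_cst (a : C) : holo (fun=> a).
Proof. by have [b hb] := norm_le_nat a; do 2 eexists; apply: expands_cst hb. Qed.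

Lemma holo_id : holo id.
Proof. by do 2 eexists; apply: expands_id. Qed.

Lemma holoD f g : holo f -> holo g -> holo (fun z => f z + g z).
Proof.
move=> Hf Hg; have [c [d [B [_ Hc Hd]]]] := holo_common Hf Hg.
by do 2 eexists; apply: expandsD Hc Hd.
Qed.

Lemma holoM f g : holo f -> holo g -> holo (fun z => f z * g z).
Proof.
move=> Hf Hg; have [c [d [B [B0 Hc Hd]]]] := holo_common Hf Hg.
by do 2 eexists; apply: expandsM Hc Hd.
Qed.

Lemma holoN f : holo f -> holo (fun z => - f z).
Proof.
move=> Hf; apply: holo_eq (holoM (holo_cst (-1)) Hf) => z.
by rewrite mulN1r.
Qed.

Lemma holoB f g : holo f -> holo g -> holo (fun z => f z - g z).
Proof. by move=> Hf Hg; apply: holoD Hf (holoN Hg). Qed.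

Lemma expands_at0 c f B : expands c f B -> c 0%N = f 0.
Proof.
move=> /(_ 1%N 0); rewrite normr0 mulr0 big_ord1 !expr0 mulr1 expr1 mulr0 => /(_ ler01).
by rewrite normr_le0 subr_eq0 => /eqP.
Qed.

Lemma holo_comp f g : holo f -> holo g -> g 0 = 0 -> holo (fun z => f (g z)).
Proof.
move=> Hf Hg g0; have [c [d [B [B0 Hc Hd]]]] := holo_common Hf Hg.
by apply: (expands_comp B0 _ Hc Hd); rewrite (expands_at0 Hd).
Qed.

(** Writing [f = f 0 * (1 - h)] with [h 0 = 0] reduces the inverse to the geometric series composed
    with [h]. *)
Lemma holoV f : holo f -> f 0 != 0 -> holo (fun z => (f z)^-1).
Proof.
move=> Hf f0; pose h z := 1 - (f 0)^-1 * f z.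
have Hh : holo h by apply: holoB (holo_cst 1) _; apply: holoM (holo_cst _) Hf.
have h0 : h 0 = 0 by rewrite /h mulVf ?subrr.
have Hg : holo (fun z : C => (1 - z)^-1) by do 2 eexists; apply: expands_geom.
apply: holo_eq (holoM (holo_cst (f 0)^-1) (holo_comp Hg Hh h0)) => z /=.
by rewrite /h opprB addrCA subrr addr0 invfM invrK mulrA mulVf // mul1r.
Qed.

Lemma holo_bounded f : holo f ->
  exists B, forall z, B%:R * `|z| <= 1 -> `|f z| <= B%:R.
Proof. by move=> [c [B H]]; exists B => z; apply: expands_bound H. Qed.

Lemma holo_neq0 f : holo f -> f 0 != 0 ->
  exists B, forall z, B%:R * `|z| <= 1 -> f z != 0.
Proof.
move=> Hf f0; have [B HB] := holo_bounded (holoV Hf f0).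
move: Hf => [c [B' H]]; have [b hb] := norm_le_nat (f 0)^-1.
(* At a zero of [f] the remainder of order one gives [|f 0| <= B'^2 |z|], hence [1 <= b B'^2 |z|];
   the factor 2 turns this into a contradiction. *)
exists (maxn B' (2 * b * B' ^ 2))%N => z hz; apply/eqP => fz.
have hz' := le1_mono (leq_maxl _ _) hz.
have := H 1%N z hz'; rewrite fz big_ord1 (expands_at0 H) expr0 mulr1 sub0r normrN expr1.
move=> h; have h1 : 1 <= b%:R * (B'%:R * (B'%:R * `|z|)).
  by rewrite -[leLHS]normr1 -[1 in leLHS](mulVf f0) normrM ler_pM.
have := le1_mono (leq_maxr _ _) hz; rewrite natrM natrM natrX => h2.
have : 2 <= 1 :> C.
  apply: le_trans h2; rewrite -[leLHS]mulr1; apply: le_trans (ler_wpM2l _ h1) _ => //.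
  by apply: le_of_eq; ring.
by rewrite lern1.
Qed.

Lemma holo_sum (I : Type) (r : seq I) (P : pred I) (F : I -> C -> C) :
  (forall i, holo (F i)) -> holo (fun z => \sum_(i <- r | P i) F i z).
Proof.
move=> HF; elim: r => [|x r IHr].
  by apply: holo_eq (holo_cst 0) => z; rewrite big_nil.
case Px: (P x).
  by apply: holo_eq (holoD (HF x) IHr) => z; rewrite big_cons Px.
by apply: holo_eq IHr => z; rewrite big_cons Px.
Qed.

Lemma holo_prod (I : Type) (r : seq I) (P : pred I) (F : I -> C -> C) :
  (forall i, holo (F i)) -> holo (fun z => \prod_(i <- r | P i) F i z).
Proof.
move=> HF; elim: r => [|x r IHr].
  by apply: holo_eq (holo_cst 1) => z; rewrite big_nil.
case Px: (P x).
  by apply: holo_eq (holoM (HF x) IHr) => z; rewrite big_cons Px.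
by apply: holo_eq IHr => z; rewrite big_cons Px.
Qed.

(** * Matrix-valued analytic functions, and passage from convergent series to remainder bounds *)

Definition holomx m n (F : C -> 'M[C]_(m, n)) := forall i j, holo (fun z => F z i j).

Lemma holomx_eq m n (F G : C -> 'M[C]_(m, n)) : F =1 G -> holomx F -> holomx G.
Proof. by move=> FG HF i j; apply: holo_eq (HF i j) => z; rewrite FG. Qed.

Lemma holomx_eq_near m n (F G : C -> 'M[C]_(m, n)) B :
  (forall z, B%:R * `|z| <= 1 -> F z = G z) -> holomx F -> holomx G.
Proof.
by move=> FG HF i j; apply: (@holo_eq_near _ _ B _ (HF i j)) => z /FG ->.
Qed.

Lemma holomx_cst m n (A : 'M[C]_(m, n)) : holomx (fun=> A).
Proof. by move=> i j; apply: holo_cst. Qed.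

Lemma holomxD m n (F G : C -> 'M[C]_(m, n)) :
  holomx F -> holomx G -> holomx (fun z => F z + G z).
Proof. by move=> HF HG i j; apply: holo_eq (holoD (HF i j) (HG i j)) => z; rewrite mxE. Qed.

Lemma holomxZ m n a (F : C -> 'M[C]_(m, n)) :
  holo a -> holomx F -> holomx (fun z => a z *: F z).
Proof. by move=> Ha HF i j; apply: holo_eq (holoM Ha (HF i j)) => z; rewrite mxE. Qed.

Lemma holomxM m n p (F : C -> 'M[C]_(m, n)) (G : C -> 'M[C]_(n, p)) :
  holomx F -> holomx G -> holomx (fun z => F z *m G z).
Proof.
move=> HF HG i j.
apply: holo_eq (holo_sum (index_enum 'I_n) xpredT (fun k => holoM (HF i k) (HG k j))).
by move=> z; rewrite mxE.
Qed.

Lemma holomx_prod n (I : Type) (r : seq I) (F : I -> C -> 'M[C]_n) :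
  (forall i, holomx (F i)) -> holomx (fun z => \prod_(i <- r) F i z).
Proof.
move=> HF; elim: r => [|x r IHr].
  by apply: holomx_eq (holomx_cst 1) => z; rewrite big_nil.
by apply: holomx_eq (holomxM (HF x) IHr) => z; rewrite big_cons.
Qed.

Lemma holo_det n (F : C -> 'M[C]_n) : holomx F -> holo (fun z => \det (F z)).
Proof.
move=> HF; apply: holo_sum => s; apply: holoM; first exact: holo_cst.
by apply: holo_prod => i; apply: HF.
Qed.

(** Cramer's rule. On a singular matrix [invmx] returns the matrix itself, so the adjugate formula
    is used only on a disc where the determinant does not vanish. *)
Lemma holomx_inv n (F : C -> 'M[C]_n) :
  holomx F -> \det (F 0) != 0 -> holomx (fun z => invmx (F z)).
Proof.
move=> HF F0; have Hd := holo_det HF; have [B HB] := holo_neq0 Hd F0.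
apply: (@holomx_eq_near _ _ (fun z => (\det (F z))^-1 *: \adj (F z)) _ B).
  by move=> z /HB hz; rewrite /invmx unitmxE unitfE hz.
apply: holomxZ; first exact: holoV.
move=> i j; apply: holo_eq (_ : holo (fun z => cofactor (F z) j i)).
  by move=> z; rewrite mxE.
apply: holoM; first exact: holo_cst.
apply: holo_det => k l; apply: holo_eq (HF (lift j k) (lift i l)) => z.
by rewrite !mxE.
Qed.

(** Abel's argument: convergence at the single point [1/be] bounds the terms there, so
    [|c n| <= K be^n], and for [be |z| <= 1/2] the tails are dominated by a geometric series. *)
Lemma series_expands c f : (exists r : C, 0 < r /\ forall z, `|z| < r ->
    series_conv_to (fun k => c k * z ^+ k) (f z)) -> exists B, expands c f B.
Proof.
move=> [r [r0 H]].
have [b hb] := norm_le_nat r^-1.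
pose be : C := b.+1%:R; have be0 : 0 < be by rewrite ltr0n.
have z1 : `|be^-1| < r.
  rewrite normfV gtr0_norm // -[ltRHS]invrK ltf_pV2 ?posrE ?invr_gt0 //.
  by rewrite -[ltLHS]ger0_norm ?invr_ge0 ?ltW // (le_lt_trans hb) // ltr_nat.
have [K HK] : exists K, forall n, `|c n| <= K%:R * be ^+ n.
  have [M HM] := H _ z1 1 ltr01.
  have [K] := norm_le_nat (\sum_(k < M) `|c k * be^-1 ^+ k|).
  rewrite ger0_norm ?sumr_ge0 // => HK.
  exists (2 + K)%N => n.
  rewrite -ler_pdivrMr ?exprn_gt0 // -exprVn.
  have -> : `|c n| * be^-1 ^+ n = `|c n * be^-1 ^+ n|.
    by rewrite normrM normrX normfV (gtr0_norm be0).
  case: (ltnP n M) => [ltnM|leMn].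
    rewrite natrD -[leLHS]add0r lerD //; apply: le_trans HK.
    rewrite (bigD1 (Ordinal ltnM)) //= ler_wpDr //.
    by rewrite sumr_ge0.
  rewrite natrD -[leLHS]addr0 lerD //.
  have h1 := HM _ leMn; have := HM _ (leqW leMn).
  rewrite big_ord_recr /= => h2.
  have := ler_normB (\sum_(k < n.+1) c k * be^-1 ^+ k - f be^-1)
     (\sum_(k < n) c k * be^-1 ^+ k - f be^-1).
  rewrite big_ord_recr.
  have -> : forall a b d : C, a + b - d - (a - d) = b by move=> *; ring.
  move=> h; apply: le_trans h _.
  by rewrite [leRHS]mulr2n lerD // ltW.
(* The summand [2 * b.+1] forces [be |z| <= 1/2]; [2 * K] is the constant in the resulting tail
   estimate. *)
exists (2 * b.+1 + 2 * K)%N => n z hz.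
have hz1 := le1_mono (leq_addr _ _) hz.
have {hz1} q2 : be * `|z| <= 2^-1.
  by rewrite -[2^-1]mulr1 ler_pdivlMl // mulrA -natrM.
set q := be * `|z|; have q0 : 0 <= q by rewrite mulr_ge0 // ltW.
have zr : `|z| < r.
  apply: le_lt_trans z1; rewrite normfV (gtr0_norm be0) -[leRHS]mulr1 ler_pdivlMl //.
  by apply: le_trans q2 _; rewrite invf_le1 // ler1n.
have geo t : \sum_(k < t) q ^+ k <= 2.
  have h : 2^-1 <= 1 - q.
    rewrite lerBrDr -lerBrDl; apply: le_trans q2 _.
    by apply: le_of_eq; field.
  have h0 : 0 < 1 - q by apply: lt_le_trans h; rewrite invr_gt0.
  rewrite -(ler_pM2l h0); apply: le_trans (_ : 1 <= _).
    have := subrX1 q t; set S := \sum_(k < t) _ => e.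
    have -> : (1 - q) * S = 1 - q ^+ t by rewrite -opprB mulNr -e opprB.
    by rewrite lerBlDr lerDl exprn_ge0.
  by rewrite mulrC -ler_pdivrMl // mulr1.
have tail t : `|\sum_(k < n + t) c k * z ^+ k - \sum_(k < n) c k * z ^+ k|
    <= K%:R * 2 * q ^+ n.
  rewrite big_split_ord /= addrAC subrr add0r.
  apply: le_trans (ler_norm_sum _ _ _) _.
  apply: le_trans (_ : \sum_(k < t) K%:R * q ^+ n * q ^+ k <= _).
    apply: ler_sum => k _; rewrite normrM normrX -mulrA -exprD exprMn mulrA.
    by rewrite ler_wpM2r ?exprn_ge0.
  by rewrite -mulr_sumr [leRHS]mulrAC ler_wpM2l ?mulr_ge0 ?exprn_ge0.
have key : `|f z - \sum_(k < n) c k * z ^+ k| <= K%:R * 2 * q ^+ n.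
  (* The order on [C] is partial, but both sides are real. If the bound failed, the excess could
     serve as [eps], and a longer partial sum within [eps] of [f z] would contradict [tail]. *)
  rewrite real_leNgt ?normr_real //; last first.
    by rewrite ger0_real // !mulr_ge0 ?exprn_ge0.
  apply/negP; rewrite -subr_gt0 => /(H z zr) [M HM].
  have := HM (n + M)%N (leq_addl _ _); apply/negP.
  rewrite -real_leNgt ?normr_real ?rpredB ?normr_real //; last first.
    by rewrite ger0_real // !mulr_ge0 ?exprn_ge0.
  rewrite lerBlDr; apply: le_trans (lerD (lexx _) (tail M)).
  rewrite [leRHS]addrC; apply: le_trans (ler_normB _ _).
  by apply: le_of_eq; congr `|_|; ring.
apply: le_trans key _; rewrite -natrM ler_pM ?exprn_ge0 //.
  by rewrite ler_nat mulnC leq_addl.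
rewrite lerXn2r ?nnegrE ?mulr_ge0 // ler_wpM2r // ler_nat.
by rewrite (leq_trans (leq_pmull b.+1 (isT : 0 < 2)%N)) // leq_addr.
Qed.

Lemma expands_series c f B z : (0 < B)%N -> expands c f B ->
  B%:R * `|z| < 2^-1 -> series_conv_to (fun k => c k * z ^+ k) (f z).
Proof.
move=> B0 H hz eps eps0.
have hz1 : B%:R * `|z| <= 1 by apply: le_trans (ltW hz) _; rewrite invf_le1 // ler1n.
have [b hb] := norm_le_nat eps^-1; exists (B * b)%N => n hn.
rewrite distrC; apply: le_lt_trans (H n z hz1) _.
apply: le_lt_trans (_ : B%:R * 2^-1 ^+ n < _).
  by rewrite ler_wpM2l // lerXn2r ?nnegrE ?mulr_ge0 ?invr_ge0 // ltW.
rewrite exprVn ltr_pdivrMr ?exprn_gt0 // -ltr_pdivrMl //.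
apply: le_lt_trans (_ : b%:R * B%:R < _).
  by rewrite ler_wpM2r // -[leLHS]ger0_norm // invr_ge0 (ltW eps0).
by rewrite -natrM -natrX ltr_nat mulnC (leq_ltn_trans hn) // ltn_expl.
Qed.

End Analytic.

(** * Conjugate transposes and J-unitary rows *)

Section Adj.
Context {R : realType}.
Local Notation C := R[i].

Lemma adjmxM m n p (A : 'M[C]_(m, n)) (B : 'M_(n, p)) : adj (A *m B) = adj B *m adj A.
Proof. by rewrite /adj map_mxM trmx_mul. Qed.

Lemma adjmxK m n (A : 'M[C]_(m, n)) : adj (adj A) = A.
Proof. by apply/matrixP => i j; rewrite !mxE conjCK. Qed.

Lemma adjmxD m n (A B : 'M[C]_(m, n)) : adj (A + B) = adj A + adj B.
Proof. by apply/matrixP => i j; rewrite !mxE rmorphD. Qed.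

Lemma adjmxN m n (A : 'M[C]_(m, n)) : adj (- A) = - adj A.
Proof. by apply/matrixP => i j; rewrite !mxE rmorphN. Qed.

Lemma adjmxB m n (A B : 'M[C]_(m, n)) : adj (A - B) = adj A - adj B.
Proof. by rewrite adjmxD adjmxN. Qed.

Lemma adjmxZ m n (a : C) (A : 'M[C]_(m, n)) : adj (a *: A) = a^* *: adj A.
Proof. by apply/matrixP => i j; rewrite !mxE rmorphM. Qed.

Lemma adjmx0 m n : adj (0 : 'M[C]_(m, n)) = 0.
Proof. by apply/matrixP => i j; rewrite !mxE rmorph0. Qed.

Lemma adjmx1 n : adj (1%:M : 'M[C]_n) = 1%:M.
Proof. by apply/matrixP => i j; rewrite !mxE rmorphMn rmorph1 eq_sym. Qed.

Lemma adj_row m n p (A : 'M[C]_(m, n)) (B : 'M_(m, p)) :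
  adj (row_mx A B) = col_mx (adj A) (adj B).
Proof. by rewrite /adj map_row_mx tr_row_mx. Qed.

Lemma adj_col m n p (A : 'M[C]_(m, n)) (B : 'M_(p, n)) :
  adj (col_mx A B) = row_mx (adj A) (adj B).
Proof. by rewrite /adj map_col_mx tr_col_mx. Qed.

Lemma adj_block m n p q (A : 'M[C]_(m, n)) (B : 'M_(m, p)) (A' : 'M_(q, n)) (B' : 'M_(q, p)) :
  adj (block_mx A B A' B') = block_mx (adj A) (adj A') (adj B) (adj B').
Proof. by rewrite /adj map_block_mx tr_block_mx. Qed.

Lemma adj_unit n (A : 'M[C]_n) : (adj A \in unitmx) = (A \in unitmx).
Proof. by rewrite /adj unitmx_tr map_unitmx. Qed.

Lemma gram_ge0 n (v : 'cV[C]_n) : 0 <= (adj v *m v) 0 0.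
Proof. by rewrite mxE sumr_ge0 // => i _; rewrite !mxE mulrC -normCK exprn_ge0. Qed.

Lemma gram_eq0 n (v : 'cV[C]_n) : (adj v *m v) 0 0 = 0 -> v = 0.
Proof.
rewrite mxE => /eqP; rewrite psumr_eq0 => [/allP h|i _]; last first.
  by rewrite !mxE mulrC -normCK exprn_ge0.
apply/matrixP => i j; rewrite ord1 mxE.
have := h i (mem_index_enum i); rewrite !mxE mulrC -normCK /=.
by rewrite expf_eq0 /= normr_eq0 => /eqP.
Qed.

Lemma unitmxP_row n (A : 'M[C]_n) : (forall v : 'rV_n, v *m A = 0 -> v = 0) -> A \in unitmx.
Proof. by move=> h; rewrite -row_free_unit; apply: inj_row_free. Qed.

Lemma adj_jmx p : adj (jmx p : 'M[C]__) = jmx p.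
Proof. by rewrite /jmx adj_block !adjmx0 adjmxN !adjmx1. Qed.

Lemma jmx_sq p : jmx p *m jmx p = 1%:M :> 'M[C]__.
Proof.
rewrite /jmx mulmx_block !mulmx0 !mul0mx !mulmx1 mulmxN mulmx1 opprK !addr0 add0r.
by rewrite -scalar_mx_block.
Qed.

(** * Rows with [b j adj b = I] and positivity of the associated matrix [C] *)

Section JUnitary.
Variables (p : nat) (b : 'M[C]_(p, p + p)).
Hypothesis bjb : b *m jmx p *m adj b = 1%:M.

Lemma lsubmx_gram : lsubmx b *m adj (lsubmx b) = 1%:M + rsubmx b *m adj (rsubmx b).
Proof.
rewrite -bjb -[b in RHS]hsubmxK adj_row /jmx mul_row_block mul_row_col.
by rewrite !mulmx0 !mulmx1 addr0 add0r mulmxN mulmx1 mulNmx row_mxKr subrK.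
Qed.

(** By [lsubmx_gram], a left null vector [v] of the first block [b1] satisfies
    [|v|^2 + |v b2|^2 = 0]. *)
Lemma lsubmx_unit : lsubmx b \in unitmx.
Proof.
apply: unitmxP_row => v vb.
have : v *m (lsubmx b *m adj (lsubmx b)) *m adj v = 0 by rewrite mulmxA vb !mul0mx.
rewrite lsubmx_gram mulmxDr mulmx1 mulmxDl mulmxA -mulmxA -adjmxM.
move=> /(congr1 (fun M : 'M_1 => M 0 0)); rewrite mxE [RHS]mxE.
have h1 := gram_ge0 (adj v); have h2 := gram_ge0 (adj (v *m rsubmx b)).
rewrite !adjmxK in h1 h2 * => /eqP; rewrite paddr_eq0 // => /andP[/eqP h _].
by rewrite -[v]adjmxK (@gram_eq0 _ (adj v)) ?adjmx0 ?adjmxK.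
Qed.

(** This is [C_k] when [b = beta k *m Kmx p]; the factor [K] turns the normalization with [J] into
    one with [j]. *)
Definition Cdil : 'M[C]_(p + p) := 2 *: (adj b *m b) - jmx p.

Lemma Cdil_adj : adj Cdil = Cdil.
Proof. by rewrite /Cdil adjmxB adjmxZ adjmxM adjmxK adj_jmx conjC_nat. Qed.

(** [C j] fixes [adj b], because [b j adj b = I]. Hence [C j C = 2 (adj b) b - C = j]. *)
Lemma Cdil_jmx_Cdil : Cdil *m jmx p *m Cdil = jmx p.
Proof.
have e1 : Cdil *m jmx p *m adj b = adj b.
  rewrite /Cdil mulmxBl mulmxBl -!scalemxAl -!mulmxA (mulmxA b) bjb mulmx1 (mulmxA (jmx p)) jmx_sq.
  by rewrite mul1mx scaler_nat mulr2n addrK.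
rewrite {2}/Cdil mulmxBr -scalemxAr mulmxA e1 -mulmxA jmx_sq mulmx1 /Cdil opprB addrC subrK //.
Qed.

Lemma Cdil_posdef : posdef Cdil.
Proof.
split; first exact: Cdil_adj.
move=> v v0.
(* With [x] chosen so that [v - j b^* x] has zero first component [y] being the second one,
[v^* C v = |x + b2 y|^2 + |b2 y|^2 + |y|^2]. *)
have [b1 [b2 [eb e12 u1]]] : exists b1 b2, [/\ b = row_mx b1 b2,
    b1 *m adj b1 = 1%:M + b2 *m adj b2 & b1 \in unitmx].
  by exists (lsubmx b), (rsubmx b); rewrite hsubmxK lsubmx_gram lsubmx_unit.
have [x hx] : exists x, adj b1 *m x = usubmx v.
  by exists (invmx (adj b1) *m usubmx v); rewrite mulmxA mulmxV ?mul1mx ?adj_unit.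
have [y hv2] : exists y, dsubmx v = y - adj b2 *m x.
  by exists (dsubmx v + adj b2 *m x); rewrite addrK.
have ev : v = col_mx (adj b1 *m x) (y - adj b2 *m x) by rewrite hx -hv2 vsubmxK.
have [a ha] : exists a, a = b2 *m y by exists (b2 *m y).
have hbv : b *m v = x + a.
  rewrite eb ev mul_row_col mulmxA e12 mulmxDl mul1mx.
  by rewrite mulmxBr !mulmxA -ha addrACA subrr addr0.
have hjv : adj v *m jmx p *m v =
   adj x *m x - adj y *m y + (adj a *m x + adj x *m a).
  rewrite ev adj_col /jmx mul_row_block mul_row_col.
  rewrite !mulmx0 !mulmx1 addr0 add0r mulmxN mulmx1 mulNmx.
  rewrite adjmxM adjmxK mulmxA -(mulmxA (adj x)) e12 mulmxDr mulmx1 mulmxDl.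
  rewrite adjmxB adjmxM adjmxK mulmxBl !mulmxBr ha adjmxM !mulmxA.
  move: (adj x *m x) (adj y *m y) (adj x *m b2 *m adj b2 *m x)
    (adj x *m b2 *m y) (adj y *m adj b2 *m x).
  by move=> A1 A2 A3 A4 A5; apply/matrixP => i k; rewrite !mxE; ring.
have -> : (adj v *m Cdil *m v) 0 0 =
    (adj (x + a) *m (x + a)) 0 0 + (adj a *m a) 0 0 + (adj y *m y) 0 0.
  rewrite /Cdil mulmxBr mulmxBl hjv -scalemxAr -scalemxAl (mulmxA (adj v)) -adjmxM -mulmxA hbv.
  rewrite adjmxD mulmxDl !mulmxDr.
  move: (adj x *m x) (adj y *m y) (adj x *m a) (adj a *m x) (adj a *m a).
  by move=> A1 A2 A3 A4 A5; rewrite !mxE; ring.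
rewrite lt_def !addr_ge0 ?gram_ge0 // andbT; apply: contra v0.
rewrite !paddr_eq0 ?addr_ge0 ?gram_ge0 // => /andP[/andP[/eqP h1 /eqP h2] /eqP h3].
move: h1; rewrite (gram_eq0 h2) addr0 => h1.
by rewrite ev (gram_eq0 h1) (gram_eq0 h3) !mulmx0 subr0 col_mx0.
Qed.
End JUnitary.

(** For a left null vector [v], the vector [u = j (adj b) (adj v)] satisfies [c u = 0], so the form
    of [Cdil c] at [u] equals [-|v|^2]. Positivity forces [u = 0], and then [v = 0]. *)
Lemma jmx_prod_unit p (b c : 'M[C]_(p, p + p)) : b *m jmx p *m adj b = 1%:M ->
  c *m jmx p *m adj c = 1%:M -> b *m jmx p *m adj c \in unitmx.
Proof.
move=> hb hc; apply: unitmxP_row => v vb0.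
pose u := jmx p *m adj b *m adj v.
have cu : c *m u = 0.
  suff -> : c *m u = adj (v *m (b *m jmx p *m adj c)) by rewrite vb0 adjmx0.
  by rewrite /u !adjmxM adjmxK adj_jmx !mulmxA.
have uju : adj u *m jmx p *m u = v *m adj v.
  rewrite /u !adjmxM !adjmxK adj_jmx !mulmxA -[_ *m jmx p *m jmx p]mulmxA jmx_sq mulmx1.
  by rewrite -(mulmxA v) -(mulmxA v) hb mulmx1.
have [_ /(_ u)] := Cdil_posdef hc.
have -> : adj u *m Cdil c *m u = - (v *m adj v).
  by rewrite /Cdil mulmxBr mulmxBl uju -scalemxAr -scalemxAl -!mulmxA cu !mulmx0 scaler0 sub0r.
have h := gram_ge0 (adj v); rewrite adjmxK in h.
case: (eqVneq u 0) => [u0 _|_ /(_ isT)]; last first.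
  by rewrite mxE oppr_gt0 => /lt_geF; rewrite h.
move: uju; rewrite u0 mulmx0 => /esym e; rewrite -[v]adjmxK (@gram_eq0 _ (adj v)) ?adjmx0 //.
by rewrite adjmxK e mxE.
Qed.

Lemma invsqrt2_sq : (2.-root (2 : C))^-1 * (2.-root (2 : C))^-1 = 2^-1.
Proof. by rewrite -invfM -expr2 rootCK. Qed.

Lemma invsqrt2_conj : ((2.-root (2 : C))^-1)^* = (2.-root (2 : C))^-1.
Proof. by rewrite conj_Creal // rpredV ger0_real // rootC_ge0. Qed.

Lemma half_double p : 2^-1 *: (1%:M + 1%:M) = 1%:M :> 'M[C]_p.
Proof. by apply/matrixP => i k; rewrite !mxE; field. Qed.

Lemma Kmx_conj_jmx p : Kmx p *m jmx p *m adj (Kmx p) = Jmx p :> 'M[C]__.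
Proof.
rewrite /Kmx /jmx /Jmx adjmxZ adj_block invsqrt2_conj -scalemxAl -scalemxAl -scalemxAr scalerA invsqrt2_sq.
rewrite !mulmx_block adjmxN !adjmx1 !mulmx0 !mulmx1 !mulmxN !mulmx1 ?opprK ?oppr0 !addr0 !add0r.
by rewrite subrr scale_block_mx opprK !scaler0 half_double.
Qed.

Lemma Kmx_unitary p : Kmx p *m adj (Kmx p) = 1%:M :> 'M[C]__.
Proof.
rewrite /Kmx adjmxZ adj_block invsqrt2_conj -scalemxAl -scalemxAr scalerA invsqrt2_sq.
rewrite !mulmx_block adjmxN !adjmx1 !mulmx1 mulNmx !mulmxN !mulmx1 opprK.
by rewrite subrr scale_block_mx !scaler0 half_double -scalar_mx_block.
Qed.

End Adj.

(** * Block triangular matrices *)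

Section Block.
Context {R : realType}.
Local Notation C := R[i].
Variables (p N : nat).
Local Notation BM := 'M[C]_(\sum_(k < N.+1) p).
Local Notation mxblk := (@mxblock C N.+1 N.+1 (fun=> p) (fun=> p)).

Definition lowerones : BM := mxblk (fun k l => if (l < k)%N then 1%:M else 0).

(** [d = 0] means block lower triangular and [d = 1] strictly so; the depths add in products, which
    yields nilpotency. *)
Definition block_lower d (A : BM) :=
  forall k l : 'I_N.+1, (k < l + d)%N -> submxblock A k l = 0.

Lemma submxblock_mul (A B : BM) k l :
  submxblock (A *m B) k l = \sum_m submxblock A k m *m submxblock B m l.
Proof. by rewrite -{1}(submxblockK A) -{1}(submxblockK B) mul_mxblock mxblockK. Qed.

Lemma block_lowerM d e (A B : BM) :
  block_lower d A -> block_lower e B -> block_lower (e + d) (A *m B).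
Proof.
move=> hA hB k l h; rewrite submxblock_mul big1 // => m _.
case: (ltnP m (l + e)) => [/hB ->|hm]; first by rewrite mulmx0.
by rewrite hA ?mul0mx //; lia.
Qed.

Lemma mxblock_id : 1%:M = mxblk (fun k l => if k == l then 1%:M else 0) :> BM.
Proof.
rewrite -mxdiagZ; apply/eq_mxblockP => i j.
by case: eqP => // _; rewrite conform_mx_id.
Qed.

Lemma block_lower_nilpotent (A : BM) : block_lower 1 A -> A ^+ N.+1 = 0.
Proof.
move=> hA.
have h n : block_lower n (A ^+ n).
  elim: n => [|n IHn]; last by rewrite exprS -add1n addnC; apply: block_lowerM.
  move=> k l; rewrite addn0 expr0 => kl.
  by rewrite [1](mxblock_id) mxblockK (negbTE (_ : k != l)) // neq_ltn kl.
rewrite -[LHS]submxblockK -[RHS]submxblockK; apply/eq_mxblockP => k l.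
by rewrite h ?submxblock0 // (leq_trans (ltn_ord k)) // leq_addl.
Qed.

(** If [v (1 + A) = 0] then [v A = -v], so [v A^n] is [v] up to sign. *)
Lemma nilpotent_unit (A : BM) n : A ^+ n = 0 -> 1%:M + A \in unitmx.
Proof.
move=> An; apply: unitmxP_row => v; rewrite mulmxDr mulmx1 => /eqP.
rewrite addrC addr_eq0 => /eqP vA.
have h m : v *m A ^+ m = (-1) ^+ m *: v.
  elim: m => [|m IHm]; first by rewrite expr0 scale1r mulmx1.
  by rewrite exprSr mulmxA IHm -scalemxAl vA scalerN exprS mulN1r scaleNr.
have := h n; rewrite An mulmx0 => /esym/eqP; rewrite scaler_eq0 => /orP[|/eqP //].
by rewrite signr_eq0.
Qed.

Lemma AmxE : Amx p N = 'i *: (2^-1 *: 1%:M + lowerones) :> BM.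
Proof.
rewrite mxblock_id -[RHS]submxblockK; apply/eq_mxblockP => k l.
have -> : forall (a b : C) (A B : BM),
    submxblock (a *: (b *: A + B)) k l = a *: (b *: submxblock A k l + submxblock B k l).
  by move=> a b A B; apply/matrixP => i j; rewrite !mxE.
rewrite !mxblockK -(inj_eq val_inj) /=; case: ltngtP => _.
- by rewrite scaler0 addr0 scaler0.
- by rewrite scaler0 add0r scalemx1.
- by rewrite addr0 scalerA scalemx1.
Qed.

(** The diagonal parts [i/2] of [A] and [-i/2] of its adjoint combine to the identity, leaving an
    equation in the nilpotent [lowerones] alone. *)
Lemma sylvester_hom (D : BM) :
  Amx p N *m D - D *m adj (Amx p N) = 'i *: (D + lowerones *m D + D *m adj lowerones).
Proof.
have half : (2^-1 : C)^* = 2^-1 by rewrite conj_Creal // rpredV ger0_real.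
rewrite AmxE !adjmxZ adjmxD adjmxZ adjmx1 conjCi half.
rewrite -scalemxAl -scalemxAr scaleNr opprK -scalerDr; congr (_ *: _).
rewrite mulmxDl mulmxDr -scalemxAl -scalemxAr mul1mx mulmx1 addrACA -scalerDl.
by rewrite -mulr2n -(mulr_natr 2^-1) mulVf ?pnatr_eq0 // scale1r addrA.
Qed.

(** Block [(k, l)] of the two products involves only blocks of [D] with a smaller index sum, so
    induction on [k + l] applies. *)
Lemma sylvester_uniq (D : BM) : D + lowerones *m D + D *m adj lowerones = 0 -> D = 0.
Proof.
move=> h.
have adjL : adj lowerones = mxblk (fun k l => if (k < l)%N then 1%:M else 0).
  rewrite -[LHS]submxblockK; apply/eq_mxblockP => k l.
  transitivity (adj (submxblock lowerones l k)).
    by apply/matrixP => i j; rewrite !mxE.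
  by rewrite mxblockK; case: ifP; rewrite ?adjmx1 ?adjmx0.
suff hD n : forall k l : 'I_N.+1, (k + l < n)%N -> submxblock D k l = 0.
  rewrite -[LHS]submxblockK -[RHS]submxblockK; apply/eq_mxblockP => k l.
  by rewrite submxblock0 (hD (k + l).+1).
elim: n => // n IHn k l kl.
have := congr1 (fun M : BM => submxblock M k l) h.
rewrite /= !submxblockD submxblock0 !submxblock_mul adjL.
rewrite [X in _ + X + _]big1 => [|m _]; last first.
  rewrite mxblockK; case: ifP => mk; rewrite ?mul0mx // IHn ?mulmx0 //; lia.
rewrite big1 => [|m _]; last first.
  rewrite mxblockK; case: ifP => mk; rewrite ?mulmx0 // IHn ?mul0mx //; lia.
by rewrite !addr0.
Qed.

(* The left kernel of the intertwiner T is L-invariant, so it is trivial as soon as no left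
null vector of L annihilates B1. *)
Lemma nilpotent_similar (L : BM) (B1 : 'M[C]_(\sum_(k < N.+1) p, p)) :
  L ^+ N.+1 = 0 ->
  (forall v : 'rV_(\sum_(k < N.+1) p), v *m L = 0 -> v *m B1 = 0 -> v = 0) ->
  exists X : BM, [/\ X \in unitmx, X *m L = lowerones *m X & X *m B1 = Phi1 p N].
Proof.
move=> LN kerL.
have uL := nilpotent_unit LN.
pose H := invmx (1%:M + L).
have LH : L *m H = H *m L.
  have e : (1%:M + L) *m L = L *m (1%:M + L) by rewrite mulmxDl mulmxDr mul1mx mulmx1.
  rewrite -[LHS]mul1mx -(mulVmx uL) -/H -!mulmxA [(1%:M + L) *m _]mulmxA e -mulmxA.
  by rewrite mulmxV // mulmx1.
have [G eG] : exists G : BM, G = H *m L by exists (H *m L).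
(* These are the block columns of [T], the inverse of [X]. The recursion [tS] makes [L t_l] the sum
   of all later [t_k], that is [L T = T L0], and the sum of all [t_k] is [(1 + L) H B1 = B1]. *)
pose t k := G ^+ k *m (H *m B1).
have tS k : t k.+1 = L *m t k - L *m t k.+1.
  have e : t k.+1 = G *m t k by rewrite /t exprS -[G * _]/(G *m _) -mulmxA.
  have -> : L *m t k = (1%:M + L) *m t k.+1.
    by rewrite e (mulmxA (1%:M + L) G) eG (mulmxA (1%:M + L) H) mulmxV // mul1mx.
  by rewrite mulmxDl mul1mx addrK.
have tN : L *m t N = 0.
  have e : GRing.comm L H by [].
  suff eGN : L *m G ^+ N = 0 by rewrite /t mulmxA eGN mul0mx.
  rewrite eG !mulmxE (GRing.exprMn_comm _ (esym e)) mulrA.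
  by rewrite (GRing.commrX N e) -mulrA -exprS LN mulr0.
have tsum l : (l <= N)%N -> \sum_(l.+1 <= k < N.+1) t k = L *m t l.
  move=> lN; rewrite big_add1 /=.
  transitivity (- \sum_(l <= k < N) (L *m t k.+1 - L *m t k)).
    by rewrite -sumrN; apply: eq_bigr => k _; rewrite opprB -tS.
  by rewrite telescope_sumr // tN sub0r opprK.
pose T : BM := @mxrow C N.+1 (fun=> p) _ (fun k => t k).
have LT : L *m T = T *m lowerones.
  rewrite mul_mxrow mul_mxrow_mxblock; apply/eq_mxrowP => l.
  rewrite -(tsum l (ltnSE (ltn_ord l))) big_geq_mkord [LHS]big_mkcond /=.
  by apply: eq_bigr => k _; case: ifP => _; rewrite ?mulmx1 ?mulmx0.
have TP : T *m Phi1 p N = B1.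
  rewrite mul_mxrow_mxcol; transitivity (\sum_(k < N.+1) t k).
    by apply: eq_bigr => k _; rewrite mulmx1.
  rewrite -(big_mkord xpredT t) [LHS]big_ltn // tsum // /t expr0 mul1mx.
  by rewrite -{1}[H *m B1]mul1mx -mulmxDl mulmxA mulmxV // mul1mx.
have LTn n : L ^+ n *m T = T *m lowerones ^+ n.
  elim: n => [|n IHn]; first by rewrite !expr0 mul1mx mulmx1.
  by rewrite exprSr -mulmxE -mulmxA LT mulmxA IHn exprSr -mulmxA.
have uT : T \in unitmx.
  apply: unitmxP_row => v vT.
  (* Descends from [L^(N+1) = 0] to [L^0]: since [v T = 0], each [v L^m] annihilates [B1 = T Phi1],
     so [kerL] removes one power of [L] at a time. *)
  have vLn n : (n <= N.+1)%N -> v *m L ^+ (N.+1 - n) = 0.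
    elim: n => [|n IHn] nN; first by rewrite subn0 LN mulmx0.
    apply: kerL; rewrite -mulmxA; last first.
      by rewrite -TP !mulmxA -(mulmxA v) LTn mulmxA vT !mul0mx.
    by rewrite mulmxE -exprSr -subSn // IHn // ltnW.
  by have := vLn N.+1 (leqnn _); rewrite subnn expr0 mulmx1.
exists (invmx T); split; first by rewrite unitmx_inv.
  by rewrite -[LHS]mulmx1 -(mulmxV uT) mulmxA -(mulmxA _ L) LT !mulmxA mulVmx // mul1mx.
by rewrite -TP mulmxA mulVmx // mul1mx.
Qed.

(** * The matrix [B J adj B] and its strictly lower block part [L] *)

Section Gram.
Variable beta : nat -> 'M[C]_(p, p + p).
Hypothesis hbeta : forall k, (k <= N)%N -> beta k *m Jmx p *m adj (beta k) = 1%:M.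

Definition Lbeta : BM := mxblk (fun k l =>
  if (l < k)%N then beta k *m Jmx p *m adj (beta l) else 0).

Lemma adj_Jmx : adj (Jmx p : 'M[C]__) = Jmx p.
Proof. by rewrite /Jmx adj_block !adjmx0 !adjmx1. Qed.

Lemma adj_mxblock (F : 'I_N.+1 -> 'I_N.+1 -> 'M[C]_p) :
  adj (mxblk F) = mxblk (fun k l => adj (F l k)).
Proof.
rewrite -[LHS]submxblockK; apply/eq_mxblockP => k l.
transitivity (adj (submxblock (mxblk F) l k)); last by rewrite mxblockK.
by apply/matrixP => i j; rewrite !mxE.
Qed.

Lemma adj_Bmx : adj (Bmx N beta) = @mxrow C N.+1 (fun=> p) _ (fun k => adj (beta k)).
Proof.
rewrite -[LHS]submxrowK; apply/eq_mxrowP => k.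
transitivity (adj (submxcol (Bmx N beta) k)); last by rewrite mxcolK.
by apply/matrixP => i j; rewrite !mxE.
Qed.

Lemma Bmx_gram : adj (Bmx N beta) *m Bmx N beta = \sum_(k < N.+1) adj (beta k) *m beta k.
Proof. by rewrite adj_Bmx mul_mxrow_mxcol. Qed.

Lemma Lbeta_adj : 1%:M + Lbeta + adj Lbeta = Bmx N beta *m Jmx p *m adj (Bmx N beta).
Proof.
rewrite adj_Bmx mxcol_mul mul_mxcol_mxrow /Lbeta adj_mxblock mxblock_id -!mxblockD.
apply/eq_mxblockP => k l; rewrite -(inj_eq val_inj) /=; case: (ltngtP (k : nat) l) => kl.
- by rewrite !add0r !adjmxM adj_Jmx adjmxK mulmxA.
- by rewrite add0r adjmx0 addr0.
- by rewrite adjmx0 !addr0 -(val_inj kl) hbeta // -ltnS.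
Qed.

Lemma Lbeta_lower : block_lower 1 Lbeta.
Proof. by move=> k l; rewrite addn1 ltnS mxblockK leqNgt => /negbTE ->. Qed.

(** A left null vector of the first block [b1] annihilates [b2 (adj b1) + b1 (adj b2) = I] as a
    quadratic form. *)
Lemma lsub_beta_unit k : (k <= N)%N -> lsubmx (beta k) \in unitmx.
Proof.
move=> /hbeta; rewrite -{1 2}[beta k]hsubmxK /Jmx mul_row_block adj_row mul_row_col.
rewrite !mulmx0 !mulmx1 addr0 add0r; move: (lsubmx _) (rsubmx _) => b1 b2 h.
apply: unitmxP_row => v vb.
have : v *m (b2 *m adj b1 + b1 *m adj b2) *m adj v = 0.
  rewrite mulmxDr mulmxDl !mulmxA vb !mul0mx addr0 -mulmxA -adjmxM vb.
  by rewrite adjmx0 mulmx0.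
rewrite h mulmx1 => e; rewrite -[v]adjmxK (@gram_eq0 _ _ (adj v)) ?adjmx0 //.
by rewrite adjmxK e mxE.
Qed.

(** Block column [k - 1] of [v L] involves only [w_k, ..., w_N], so the invertible subdiagonal
    blocks kill the [w_k] from the last one down to [w_1]. The remaining [w_0] is killed by the
    first block of [B1]. *)
Lemma Lbeta_observable (hunit : forall k, (k < N)%N ->
    beta k.+1 *m Jmx p *m adj (beta k) \in unitmx) (v : 'rV_(\sum_(k < N.+1) p)) :
  v *m Lbeta = 0 -> v *m lsubmx (Bmx N beta) = 0 -> v = 0.
Proof.
move=> vL vB.
pose w (k : 'I_N.+1) := submxrow v k.
have ew : v = @mxrow C N.+1 (fun=> p) _ w by rewrite submxrowK.
have hL (l : 'I_N.+1) : \sum_(k < N.+1 | (l < k)%N) w k *m (beta k *m Jmx p *m adj (beta l)) = 0.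
  have := congr1 (fun M => submxrow M l) vL.
  rewrite /= ew mul_mxrow_mxblock mxrowK submxrow0 => e; rewrite -[RHS]e [LHS]big_mkcond /=.
  by apply: eq_bigr => k _; case: ifP => _; rewrite ?mulmx0.
have w0 n : forall k : 'I_N.+1, (0 < k)%N -> (N - n < k)%N -> w k = 0.
  elim: n => [|n IHn] k k0 nk.
    by move: nk; rewrite subn0 ltnNge -ltnS ltn_ord.
  case: (ltnP (N - n) k) => [|kn]; first exact: IHn.
  have lN : (k.-1 < N.+1)%N by rewrite (leq_ltn_trans (leq_pred _)).
  have := hL (Ordinal lN); rewrite [LHS](bigD1 k) /= ?prednK // big1 ?addr0; last first.
    move=> m /andP[]; rewrite leq_eqVlt => /orP[/eqP e|km] mk.
      by rewrite (val_inj e) eqxx in mk.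
    rewrite (IHn m) ?mul0mx //; first exact: leq_trans km.
    by move: nk km; clear; lia.
  have := hunit k.-1; rewrite prednK // => /(_ (ltnSE (ltn_ord k))) u
    /(congr1 (mulmx^~ (invmx (beta k *m Jmx p *m adj (beta k.-1))))).
  by rewrite /= mulmxK // mul0mx.
have wk (k : 'I_N.+1) : k != ord0 -> w k = 0.
  by rewrite -(inj_eq val_inj) /= -lt0n => k0; rewrite (w0 N) // subnn.
have w00 : w ord0 = 0.
  have eB : lsubmx (Bmx N beta) = @mxcol C N.+1 (fun=> p) _ (fun k => lsubmx (beta k)).
    by apply/matrixP => i j; rewrite !mxE.
  move: vB; rewrite eB {1}ew mul_mxrow_mxcol (bigD1 ord0) //= big1 ?addr0; last first.
    by move=> k /wk wk0; rewrite [X in X *m _]wk0 mul0mx.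
  move=> /(congr1 (mulmx^~ (invmx (lsubmx (beta 0))))).
  by rewrite /= mulmxK ?lsub_beta_unit // mul0mx.
rewrite ew -[RHS](submxrowK 0); apply/eq_mxrowP => k; rewrite submxrow0.
by case: (eqVneq k ord0) => [->|/wk].
Qed.

End Gram.
End Block.

(** * Partial sums of the Taylor coefficients *)

Section Core.
Context {R : realType}.
Local Notation C := R[i].

Lemma small_eq0 (a : C) k M :
  (forall z : C, M%:R * `|z| <= 1 -> `|a * z ^+ k| <= M%:R * `|z| ^+ k.+1) -> a = 0.
Proof.
move=> H; apply/eqP; apply: contraT => a0.
(* At [z = 1/m] the hypothesis reads [|a| m <= M]. The choice of [m] exceeds [M], so the point is
   admissible, and exceeds [b M], which is at least [M/|a|]. *)
have [b hb] := norm_le_nat a^-1; pose m : nat := (b * M + M).+1.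
have m0 : 0 < m%:R :> C by rewrite ltr0n.
have em : `|m%:R^-1 : C| = m%:R^-1 by rewrite ger0_norm // invr_ge0.
have := H m%:R^-1; rewrite normrM normrX em exprSr mulrA mulrAC.
rewrite ler_pdivrMr // mul1r ler_nat.
have -> : (M <= m)%N by rewrite leqW // leq_addl.
move=> /(_ isT); rewrite ler_pM2r ?exprn_gt0 ?invr_gt0 // ler_pdivlMr // => h.
have : m%:R <= (b * M)%:R :> C.
  rewrite natrM; apply: le_trans (ler_pM _ _ hb h) => //; last first.
    by rewrite mulr_ge0.
  by rewrite mulrA -normrM mulVf // normr1 mul1r.
by rewrite ler_nat ltnNge leq_addr.
Qed.

(** Strong induction on [k]. Replacing [psi] by Taylor polynomials in the estimate for [K = k + 1],
    the terms below [k] cancel and [(x k - S k) z^k] is bounded by a multiple of [|z|^(k+1)], so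
    [small_eq0] applies. *)
Lemma partial_sums (x al : nat -> C) (psi : C -> C) B n : expands al psi B ->
  (forall K, (K <= n.+1)%N -> exists M, forall z : C, M%:R * `|z| <= 1 ->
    `|\sum_(k < K) z ^+ k * (x k - psi z)| <= M%:R * `|z| ^+ K) ->
  forall k, (k <= n)%N -> x k = \sum_(r < k.+1) al r.
Proof.
move=> /(expands_mono (leqnSn B)); move: B.+1 (ltn0Sn B) => {}B B0 Hal H.
elim/ltn_ind => k IHk kn.
pose S i := \sum_(r < i.+1) al r; rewrite -/(S k).
have [M HM] := H k.+1 kn.
apply/eqP; rewrite -subr_eq0; apply/eqP.
apply: (@small_eq0 _ k (B + (M + k.+1 * (B * B ^ k.+1)))) => z hz.
have hB := le1_mono (leq_addr _ _) hz.
have hM : M%:R * `|z| <= 1 by apply: le1_mono hz; rewrite addnCA leq_addr.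
have -> : (x k - S k) * z ^+ k = \sum_(i < k.+1) z ^+ i * (x i - psi z) +
    \sum_(i < k.+1) z ^+ i * (psi z - \sum_(m < k.+1 - i) al m * z ^+ m).
  (* Cauchy product with the constant sequence 1, whose convolution with [al] gives the partial sums
     [S i]. *)
  have eS : \sum_(i < k.+1) z ^+ i * (\sum_(m < k.+1 - i) al m * z ^+ m)
     = \sum_(i < k.+1) S i * z ^+ i.
    have := conv_sum (fun=> 1) al z k.+1.
    under [X in _ = X -> _]eq_bigr do rewrite mul1r.
    move=> <-; apply: eq_bigr => i _; congr (_ * _).
    rewrite /conv (reindex_inj rev_ord_inj) /=; apply: eq_bigr => j _.
    by rewrite mul1r subSS subKn // -ltnS.
  under [X in _ = _ + X]eq_bigr do rewrite mulrBr.
  rewrite sumrB eS -sumrB -big_split /= big_ord_recr /= big1 ?add0r => [|i _].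
    by ring.
  by rewrite IHk 1?(leq_trans (ltnW (ltn_ord i))) // -/(S i); ring.
apply: le_trans (ler_normD _ _) _.
rewrite natrD natrD !mulrDl -[leLHS]add0r lerD ?mulr_ge0 ?exprn_ge0 //.
rewrite lerD ?HM //.
apply: le_trans (ler_norm_sum _ _ _) _.
apply: le_trans (_ : \sum_(i < k.+1) (B * B ^ k.+1)%:R * `|z| ^+ k.+1 <= _); last first.
  by rewrite sumr_const card_ord -mulrnAl -mulrnA mulnC.
apply: ler_sum => i _; rewrite normrM normrX.
apply: le_trans (ler_wpM2l _ (Hal (k.+1 - i)%N z hB)) _; first by rewrite exprn_ge0.
have -> : `|z| ^+ k.+1 = `|z| ^+ i * `|z| ^+ (k.+1 - i) by rewrite -exprD subnKC // ltnW.
rewrite [(B%:R * `|z|) ^+ _]exprMn.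
have -> : forall a b d e : C, a * (b * (d * e)) = b * d * (a * e) by move=> *; ring.
rewrite ler_wpM2r ?mulr_ge0 ?exprn_ge0 // natrM ler_wpM2l //.
by rewrite -natrX ler_nat leq_pexp2l // leq_subr.
Qed.

Lemma holomx_mxcol n p q (F : 'I_n -> C -> 'M[C]_(p, q)) :
  (forall k, holomx (F k)) -> holomx (fun z => @mxcol C n (fun=> p) q (fun k => F k z)).
Proof.
by move=> HF i j; apply: holo_eq (HF (tagnat.sig1 i) (tagnat.sig2 i) j) => z; rewrite mxE.
Qed.

(** * The factors [E_k(z)] and the block rows of [B J Y_0] *)

Section Factors.
Variables (p N : nat) (beta : nat -> 'M[C]_(p, p + p)).
Hypothesis hbeta : forall k, (k <= N)%N -> beta k *m Jmx p *m adj (beta k) = 1%:M.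

Definition Efac k (z : C) : 'M[C]_(p + p) :=
  1%:M - (1 - z) *: (adj (beta k) *m beta k *m Jmx p).

Lemma holomx_Efac k : holomx (Efac k).
Proof.
apply: (@holomx_eq _ _ _ (fun z => 1%:M + (z - 1) *: (adj (beta k) *m beta k *m Jmx p))).
  by move=> z; rewrite /Efac -opprB scaleNr.
apply: holomxD; first exact: holomx_cst.
apply: holomxZ; last exact: holomx_cst.
by apply: holoB; [exact: holo_id | exact: holo_cst].
Qed.

Lemma beta_Efac k z : (k <= N)%N ->
  beta k *m Jmx p *m Efac k z = z *: (beta k *m Jmx p).
Proof.
move=> kN; rewrite /Efac mulmxBr mulmx1 -scalemxAr !mulmxA hbeta // mul1mx.
by rewrite scalerBl scale1r opprB addrC subrK.
Qed.

Variable (G : 'M[C]_(p + p, p)).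

Definition tailprod k z : 'M[C]_(p + p, p) := \prod_(k <= i < N.+1) Efac i z *m G.

Definition uvec z k : 'M[C]_p := beta k *m Jmx p *m tailprod k.+1 z.

Lemma tailprod_rec k z : (k <= N)%N -> tailprod k z = Efac k z *m tailprod k.+1 z.
Proof. by move=> kN; rewrite /tailprod big_ltn // -mulmxE -mulmxA. Qed.

Lemma tailprodS k z : (k <= N)%N ->
  tailprod k z = tailprod k.+1 z - (1 - z) *: (adj (beta k) *m uvec z k).
Proof.
move=> kN; rewrite tailprod_rec //.
by rewrite /Efac mulmxBl mul1mx -scalemxAl /uvec !mulmxA.
Qed.

Lemma tailprod0 k z : (k <= N.+1)%N ->
  tailprod 0 z = tailprod k z - (1 - z) *: \sum_(l < k) adj (beta l) *m uvec z l.
Proof.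
elim: k => [|k IHk] kN; first by rewrite big_ord0 scaler0 subr0.
rewrite (IHk (ltnW kN)) (tailprodS z (ltnSE kN)) big_ord_recr scalerDr.
by rewrite [X in _ = _ - X]addrC opprD addrA.
Qed.

(** Telescoping rewrites [Y_0] as [Y_k] plus contributions of the factors before [k]. These give row
    [k] of [L u], while [beta_Efac] turns the term with [Y_k] into [z u_k]. *)
Lemma beta_tailprod k z : (k <= N)%N -> beta k *m Jmx p *m tailprod 0 z =
  z *: uvec z k - (1 - z) *: \sum_(l < k) beta k *m Jmx p *m adj (beta l) *m uvec z l.
Proof.
move=> kN; rewrite (@tailprod0 k) 1?ltnW // mulmxBr -scalemxAr mulmx_sumr.
congr (_ - _ *: _); last by apply: eq_bigr => l _; rewrite mulmxA.
by rewrite tailprod_rec // mulmxA beta_Efac // -scalemxAl.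
Qed.

Lemma Bmx_tailprod z (u := @mxcol C N.+1 (fun=> p) p (fun k => uvec z k)) :
  Bmx N beta *m Jmx p *m tailprod 0 z = z *: (u + Lbeta N beta *m u) - Lbeta N beta *m u.
Proof.
rewrite /Bmx !mxcol_mul -[RHS]submxcolK; apply/eq_mxcolP => k.
have -> : forall A B D : 'M[C]_(\sum_(k < N.+1) p, p),
    submxcol (z *: (A + B) - D) k = z *: (submxcol A k + submxcol B k) - submxcol D k.
  by move=> A B D; apply/matrixP => i j; rewrite !mxE.
rewrite mul_mxblock_mxrow !mxcolK beta_tailprod; last by rewrite -ltnS.
have -> : \sum_(j < N.+1) (if (j < k)%N then beta k *m Jmx p *m adj (beta j) else 0) *m uvec z j
    = \sum_(l < k) beta k *m Jmx p *m adj (beta l) *m uvec z l.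
  rewrite (big_ord_widen N.+1 (fun l => beta k *m Jmx p *m adj (beta l) *m uvec z l)) 1?ltnW //.
  by rewrite [RHS]big_mkcond; apply: eq_bigr => j _ /=; case: ifP => _; rewrite ?mul0mx.
by rewrite scalerBl scale1r scalerDr opprB addrA.
Qed.
End Factors.

(** [nilpotent_similar] supplies [X] together with the first block column of [X B]; the second one
    is identified by [partial_sums], entry by entry. *)
Lemma intertwiner p N (beta : nat -> 'M[C]_(p, p + p)) (al : nat -> 'M[C]_p)
    (psi : C -> 'M[C]_p) (G : C -> 'M[C]_(p + p, p)) B0 :
  (forall k, (k <= N)%N -> beta k *m Jmx p *m adj (beta k) = 1%:M) ->
  (forall k, (k < N)%N -> beta k.+1 *m Jmx p *m adj (beta k) \in unitmx) ->
  (forall z, B0%:R * `|z| <= 1 -> tailprod N beta (G z) 0 z = col_mx 1%:M (- psi z)) ->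
  holomx G ->
  (forall i j, exists B, expands (fun k => al k i j) (fun z => psi z i j) B) ->
  exists X : 'M[C]_(\sum_(k < N.+1) p), [/\ X \in unitmx,
    X *m Lbeta N beta = lowerones p N *m X & X *m Bmx N beta = Pimx N al].
Proof.
move=> hbeta hunit hG HG Hal.
have [X [uX XL XB]] := nilpotent_similar (block_lower_nilpotent (@Lbeta_lower _ p N beta))
   (Lbeta_observable hbeta hunit).
exists X; split => //.
suff XB2 : X *m rsubmx (Bmx N beta) = Phi2 N al.
  by rewrite -(hsubmxK (Bmx N beta)) mul_mx_row XB XB2.
pose u z := @mxcol C N.+1 (fun=> p) p (fun k => uvec N beta (G z) z k).
pose w z := X *m u z.
have Hw : holomx w.
  apply: holomxM; first exact: holomx_cst.
  apply: holomx_mxcol => k; apply: holomxM; first exact: holomx_cst.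
  apply: holomxM HG; apply: holomx_prod => i; exact: holomx_Efac.
pose Xb k : 'M[C]_p := submxcol (X *m rsubmx (Bmx N beta)) (inord k : 'I_N.+1).
(* Partial block sums of [w = X u]: row [k] of [L0 w] is [s k], and row [k] of [w + L0 w] is
   [s k.+1]. *)
pose s K z : 'M[C]_p := \sum_(l < N.+1 | (l < K)%N) submxcol (w z) l.
have Hs K i j : holo (fun z => s K z i j).
  apply: holo_eq (_ : holo (fun z => \sum_(l < N.+1 | (l < K)%N) submxcol (w z) l i j)).
    by move=> z; rewrite summxE.
  apply: holo_sum => l; apply: holo_eq (Hw (tagnat.Rank l i) j) => z.
  by rewrite [RHS]mxE.
have sS k z : (k <= N)%N -> s k.+1 z = submxcol (w z) (inord k) + s k z.
  move=> kN; rewrite /s (bigD1 (inord k)) /= ?inordK //; congr (_ + _).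
  apply: eq_bigl => l; rewrite ltnS -(inj_eq val_inj) /= inordK // andbC.
  by rewrite -ltn_neqAle.
have row_eq z k : B0%:R * `|z| <= 1 -> (k <= N)%N -> Xb k - psi z = z *: s k.+1 z - s k z.
  move=> hz kN; have := Bmx_tailprod hbeta (G z) z; rewrite hG // -/(u z).
  rewrite -{1}(hsubmxK (Bmx N beta)) /Jmx mul_row_block mul_row_col.
  rewrite !mulmx0 !mulmx1 addr0 add0r mulmxN => /(congr1 (mulmx X)).
  rewrite !mulmxBr mulmxA XB -scalemxAr mulmxDr !mulmxA XL -!mulmxA -/(w z).
  move=> /(congr1 (fun M => submxcol M (inord k : 'I_N.+1))) /=.
  have scol (A : 'M[C]_(\sum_(k < N.+1) p, p)) :
      submxcol (z *: A) (inord k : 'I_N.+1) = z *: submxcol A (inord k).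
    by apply/matrixP => i j; rewrite !mxE.
  have hL : submxcol (lowerones p N *m w z) (inord k) = s k z.
    rewrite -{1}(submxcolK (w z)) mul_mxblock_mxrow mxcolK /s [RHS]big_mkcond.
    apply: eq_bigr => l _; rewrite inordK //.
    by case: ifP => _; rewrite ?mul1mx ?mul0mx.
  rewrite !submxcolB mxcol_mul mxcolK mul1mx -/(Xb k) => ->.
  by rewrite scol submxcolD hL sS.
(* By [row_eq] the summands are [z^(k+1) s_(k+1) - z^k s_k], and [s_0] is an empty sum. *)
have tele K z : B0%:R * `|z| <= 1 -> (K <= N.+1)%N ->
    \sum_(k < K) z ^+ k *: (Xb k - psi z) = z ^+ K *: s K z.
  move=> hz; elim: K => [|K IHK] KN.
    by rewrite big_ord0 /s big_pred0 ?scaler0.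
  rewrite big_ord_recr IHK 1?ltnW //= row_eq // scalerBr scalerA -exprSr.
  by rewrite addrC subrK.
have key i j k : (k <= N)%N -> Xb k i j = \sum_(r < k.+1) al r i j.
  have [B HB] := Hal i j.
  move: k; apply: (@partial_sums (fun k => Xb k i j) _ _ B N HB) => K KN.
  have [M HM] := holo_bounded (Hs K i j).
  exists (maxn B0 M) => z hz.
  have hz0 := le1_mono (leq_maxl _ _) hz; have hz1 := le1_mono (leq_maxr _ _) hz.
  have := congr1 (fun A : 'M_p => A i j) (tele K z hz0 KN).
  rewrite summxE !mxE => e.
  have -> : \sum_(k < K) z ^+ k * (Xb k i j - psi z i j) = z ^+ K * s K z i j.
    by rewrite -e; apply: eq_bigr => l _; rewrite !mxE.
  rewrite normrM normrX mulrC ler_wpM2r ?exprn_ge0 //.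
  by apply: le_trans (HM z hz1) _; rewrite ler_nat leq_maxr.
rewrite -[LHS]submxcolK; apply/eq_mxcolP => k; apply/matrixP => i j.
have := key i j k (ltnSE (ltn_ord k)); rewrite /Xb inord_val => ->.
by rewrite summxE (big_ord_widen N.+1 (fun r => al r i j)).
Qed.
End Core.

(** * The Weyl function *)

Section WeylFunction.
Context {R : realType}.
Local Notation C := R[i].

Lemma CmxE p (beta : nat -> 'M[C]_(p, p + p)) k : Cmx beta k = Cdil (beta k *m Kmx p).
Proof. by rewrite /Cmx /Cdil adjmxM !mulmxA. Qed.

Lemma beta_Kmx p (b : 'M[C]_(p, p + p)) :
  b *m Jmx p *m adj b = 1%:M -> (b *m Kmx p) *m jmx p *m adj (b *m Kmx p) = 1%:M.
Proof. by move=> <-; rewrite adjmxM -Kmx_conj_jmx !mulmxA. Qed.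

Lemma near0_neq (z : C) : 2%:R * `|z| <= 1 -> (1 + z != 0) && (z - 1 != 0).
Proof.
move=> hz; apply/andP; split; apply/eqP => e; move: hz.
  have -> : z = - 1 by apply/eqP; rewrite -addr_eq0 addrC e.
  by rewrite normrN normr1 mulr1 lern1.
by rewrite (subr0_eq e) normr1 mulr1 lern1.
Qed.

Definition lam (z : C) : C := 'i * (z + 1) / (z - 1).

Lemma i_div_lam (z : C) : 1 + z != 0 -> z - 1 != 0 -> 'i / lam z = (z - 1) / (1 + z).
Proof. by move=> h1 h2; rewrite /lam; field; rewrite h1 h2 neq0Ci. Qed.

Lemma conj_i_div (l : C) : ('i / l^*)^* = - ('i / l).
Proof. by rewrite rmorphM fmorphV /= conjCK conjCi mulNr. Qed.

Lemma mul_conjugates n (K P Q : 'M[C]_n) a b : K *m adj K = 1%:M ->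
  (a *: (adj K *m (P *m K))) *m (b *: (adj K *m Q *m K)) =
  (a * b) *: (adj K *m (P *m Q *m K)).
Proof.
move=> KK; rewrite -scalemxAl -scalemxAr scalerA !mulmxA.
by rewrite -(mulmxA _ K (adj K)) KK mulmx1.
Qed.

(** The adjoint puts the factor of step [k] on the right, so the recursion builds the ordered
    product [E_0 ... E_(k-1)]. *)
Lemma adj_Wmx p (beta : nat -> 'M[C]_(p, p + p)) k z : 1 + z != 0 -> z - 1 != 0 ->
  adj (Wmx beta k (lam z)^*) =
  (2 / (1 + z)) ^+ k *: (adj (Kmx p) *m (\prod_(0 <= i < k) Efac beta i z *m Kmx p)).
Proof.
move=> h1 h2.
have K1 : adj (Kmx p) *m Kmx p = 1%:M :> 'M[C]__ by apply: mulmx1C; apply: Kmx_unitary.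
have JK : Jmx p *m Kmx p = Kmx p *m jmx p :> 'M[C]__.
  by rewrite -Kmx_conj_jmx -mulmxA K1 mulmx1.
elim: k => [|k IHk].
  by rewrite big_nil expr0 scale1r mul1mx K1 adjmx1.
rewrite [Wmx _ _ _]/= adjmxB adjmxZ !adjmxM adj_jmx CmxE Cdil_adj {}IHk.
have -> : ('i / (lam z)^*)^* = - ((z - 1) / (1 + z)) :> C.
  by rewrite conj_i_div i_div_lam.
rewrite scaleNr opprK big_nat_recr //=; set P := \prod_(0 <= i < k) _.
(* With [M = (adj b) b j] and [b = beta k *m Kmx p], [C_k j = 2M - 1]; taking [2/(1+z)] out leaves
   [1 - (1-z) M], which is [E_k] conjugated by [K]. *)
have step : 1%:M + ((z - 1) / (1 + z)) *: (Cdil (beta k *m Kmx p) *m jmx p)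
    = (2 / (1 + z)) *: (adj (Kmx p) *m Efac beta k z *m Kmx p).
  have -> : adj (Kmx p) *m Efac beta k z *m Kmx p =
      1%:M - (1 - z) *: (adj (beta k *m Kmx p) *m (beta k *m Kmx p) *m jmx p).
    move: (Kmx p) K1 JK => K K1 JK.
    rewrite /Efac mulmxBr mulmxBl mulmx1 K1 -scalemxAr -scalemxAl adjmxM.
    by rewrite -!mulmxA JK.
  rewrite /Cdil mulmxBl -scalemxAl jmx_sq; move: (_ *m _ *m _) => M.
  apply/matrixP => i l; rewrite !mxE; field.
  by rewrite h1.
set a := _ / _; set W := _ *: (adj _ *m _); set M := Cdil _ *m _.
have -> : W + (z - 1) / (1 + z) *: (W *m M) = W *m (1%:M + ((z - 1) / (1 + z)) *: M).
  by rewrite mulmxDr mulmx1 scalemxAr.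
by rewrite step -/a /W exprSr (mul_conjugates _ _ _ _ (Kmx_unitary p)).
Qed.

Lemma calW_lam p (beta : nat -> 'M[C]_(p, p + p)) N z : 1 + z != 0 -> z - 1 != 0 ->
  calW beta N (lam z) =
  (2 / (1 + z)) ^+ N.+1 *: (\prod_(0 <= i < N.+1) Efac beta i z *m Kmx p).
Proof.
move=> h1 h2; rewrite /calW adj_Wmx //.
by rewrite -(scalemxAr _ (Kmx p)) (mulmxA (Kmx p)) Kmx_unitary mul1mx.
Qed.

Lemma block_mul_col p (W : 'M[C]_(p + p)) (A B : 'M[C]_p) :
  ulsubmx W *m A + ursubmx W *m B = usubmx (W *m col_mx A B) /\
  dlsubmx W *m A + drsubmx W *m B = dsubmx (W *m col_mx A B).
Proof. by rewrite -{3 6}[W]submxK mul_block_col col_mxKu col_mxKd. Qed.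

(** Recentring [F] at [-i] leaves a composition with [lam z + i], which vanishes at [z = 0]. *)
Lemma analytic_lam m n (F : C -> 'M[C]_(m, n)) :
  analytic_at F (- 'i) -> holomx (fun z => F (lam z)).
Proof.
move=> [c [r [r0 H]]] i j.
have Hf : holo (fun w => F (w - 'i) i j).
  have [B HB] : exists B, expands (fun k => c k i j) (fun w => F (w - 'i) i j) B.
    apply: series_expands; exists r; split=> // w hw.
    by have := H (w - 'i); rewrite opprK subrK; apply.
  by exists (fun k => c k i j), B.
have Hg : holo (fun z => lam z + 'i).
  apply: holoD (holo_cst _); apply: holoM; last first.
    apply: holoV; first exact: holoB holo_id (holo_cst _).
    by rewrite sub0r oppr_eq0 oner_eq0.
  by apply: holoM (holo_cst _) _; apply: holoD holo_id (holo_cst _).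
have g0 : lam 0 + 'i = 0 :> C.
  by rewrite /lam add0r sub0r mulr1 invrN invr1 mulrN1 addNr.
by apply: holo_eq (holo_comp Hf Hg g0) => z /=; rewrite addrK.
Qed.

Lemma powser_expands m n (c : nat -> 'M[C]_(m, n)) (F : C -> 'M[C]_(m, n)) :
  powser_expansion 0 c F -> forall i j, exists B,
  expands (fun k => c k i j) (fun z => F z i j) B.
Proof.
move=> [r [r0 H]] i j; apply: series_expands; exists r; split=> // z hz.
by have := H z; rewrite subr0; apply.
Qed.

Lemma holomx_powser m n (F : C -> 'M[C]_(m, n)) :
  holomx F -> exists c, powser_expansion 0 c F.
Proof.
move=> HF.
have [c Hc] : exists c : 'I_m -> 'I_n -> nat -> C, forall i j, exists B,
    expands (c i j) (fun z => F z i j) B.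
  have [c Hc] := fin_all_exists (fun i => fin_all_exists (HF i)).
  by exists c.
exists (fun k => \matrix_(i, j) c i j k).
have [B HB] : exists B, forall i j, expands (c i j) (fun z => F z i j) B.
  have [b Hb] := fin_all_exists (fun i => fin_all_exists (Hc i)).
  exists (\max_i \max_j b i j) => i j; apply: expands_mono (Hb i j).
  by apply: leq_trans (leq_bigmax i); apply: (leq_bigmax j).
have BR0 : 0 < B.+1%:R :> C by rewrite ltr0n.
exists (B.+1%:R^-1 * 2^-1); split; first by rewrite mulr_gt0 ?invr_gt0.
move=> z; rewrite subr0 ltr_pdivlMl // => hz i j eps eps0.
have [M HM] := expands_series (ltn0Sn B) (expands_mono (leqnSn B) (HB i j)) hz eps0.
exists M => l /HM; apply: le_lt_trans; apply: le_of_eq; congr `|_ - _|.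
by apply: eq_bigr => k _; rewrite mxE.
Qed.

Lemma scale_quot p (a : C) (X Y : 'M[C]_p) : a != 0 -> Y \in unitmx ->
  (a *: X) *m invmx (a *: Y) = X *m invmx Y.
Proof.
move=> a0 uY; rewrite invmxZ; last first.
  by move: uY; rewrite !unitmxE !unitfE detZ mulf_eq0 expf_eq0 (negPf a0) andbF.
by rewrite -scalemxAl -scalemxAr scalerA mulfV // scale1r.
Qed.

(* The scalar factors (2 / (1 + z))^(N+1) cancel in the quotient defining phi. *)
Lemma fz_factor p N (beta : nat -> 'M[C]_(p, p + p)) (Rf Qf : C -> 'M[C]_p) :
  admissible N beta Rf Qf ->
  holomx (fz beta N Rf Qf) /\
  exists (G : C -> 'M[C]_(p + p, p)) (B0 : nat), holomx G /\
  forall z, B0%:R * `|z| <= 1 ->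
    tailprod N beta (G z) 0 z = col_mx 1%:M (- fz beta N Rf Qf z).
Proof.
move=> [_ HR HQ Hdet].
pose V z := tailprod N beta (Kmx p *m col_mx (Rf (lam z)) (Qf (lam z))) 0 z.
have HK : holomx (fun z => Kmx p *m col_mx (Rf (lam z)) (Qf (lam z))).
  apply: holomxM; first exact: holomx_cst.
  move=> i j; rewrite -(splitK i); case: (split i) => k /=.
    by apply: holo_eq (analytic_lam HR k j) => z; rewrite col_mxEu.
  by apply: holo_eq (analytic_lam HQ k j) => z; rewrite col_mxEd.
have HV : holomx V by apply: holomxM HK; apply: holomx_prod => i; apply: holomx_Efac.
have HVu : holomx (fun z => usubmx (V z)).
  by move=> i j; apply: holo_eq (HV (lshift p i) j) => z; rewrite [RHS]mxE.
have HVd : holomx (fun z => dsubmx (V z)).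
  by move=> i j; apply: holo_eq (HV (rshift p i) j) => z; rewrite [RHS]mxE.
have eV z : 1 + z != 0 -> z - 1 != 0 ->
    calW beta N (lam z) *m col_mx (Rf (lam z)) (Qf (lam z)) = (2 / (1 + z)) ^+ N.+1 *: V z.
  by move=> h1 h2; rewrite calW_lam // -scalemxAl -mulmxA.
have lam0 : lam 0 = - 'i :> C.
  by rewrite /lam add0r sub0r mulr1 invrN invr1 mulrN1.
(* [z = 0] corresponds to [lambda = -i], so up to a scalar this is the determinant assumed
   nonzero. *)
have V0 : \det (usubmx (V 0)) != 0.
  apply: contraNneq Hdet => e; rewrite -lam0 /calW11 /calW12.
  rewrite (block_mul_col _ _ _).1 eV ?addr0 ?sub0r ?oppr_eq0 ?oner_eq0 //.
  by rewrite linearZ /= detZ e mulr0.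
have [B1 HB1] := holo_neq0 (holo_det HVu) V0.
have efz z : 2%:R * `|z| <= 1 -> B1%:R * `|z| <= 1 ->
    fz beta N Rf Qf z = - (dsubmx (V z) *m invmx (usubmx (V z))).
  move=> /near0_neq/andP[h1 h2] /HB1 hd.
  rewrite /fz /phi -/(lam z) scalerA -expr2 sqrCi scaleN1r; congr (- _).
  rewrite (block_mul_col _ _ _).1 (block_mul_col _ _ _).2 eV // !linearZ /=.
  by rewrite scale_quot ?unitmxE ?unitfE // expf_neq0 // mulf_neq0 ?invr_eq0 ?pnatr_eq0.
have Hinv := holomx_inv HVu V0.
split.
  apply: (@holomx_eq_near _ _ _ (fun z => (-1) *: (dsubmx (V z) *m invmx (usubmx (V z)))) _ (maxn 2 B1)).
    move=> z hz; rewrite efz ?scaleN1r //.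
      exact: le1_mono (leq_maxl _ _) hz.
    exact: le1_mono (leq_maxr _ _) hz.
  by apply: holomxZ (holo_cst _) _; apply: holomxM HVd Hinv.
(* Dividing on the right by the upper block of [V] normalizes that block to the identity. *)
exists (fun z => Kmx p *m col_mx (Rf (lam z)) (Qf (lam z)) *m invmx (usubmx (V z))), (maxn 2 B1).
split; first exact: holomxM.
move=> z hz; have h2 := le1_mono (leq_maxl _ _) hz; have h1 := le1_mono (leq_maxr _ _) hz.
have uV : usubmx (V z) \in unitmx by rewrite unitmxE unitfE HB1.
transitivity (col_mx (usubmx (V z)) (dsubmx (V z)) *m invmx (usubmx (V z))).
  by rewrite vsubmxK /tailprod mulmxA.
by rewrite efz // opprK mul_col_mx mulmxV.
Qed.

(** * Properties of [C_k], the solution [S], and recovery of the [C_k] *)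

Lemma Cmx_props p (beta : nat -> 'M[C]_(p, p + p)) k :
  beta k *m Jmx p *m adj (beta k) = 1%:M ->
  [/\ adj (Cmx beta k) = Cmx beta k, Cmx beta k *m jmx p *m Cmx beta k = jmx p &
      posdef (Cmx beta k)].
Proof.
move=> /beta_Kmx h; rewrite CmxE.
by split; [exact: Cdil_adj | exact: Cdil_jmx_Cdil | exact: Cdil_posdef].
Qed.

Lemma beta_J_beta_unit p (b c : 'M[C]_(p, p + p)) : b *m Jmx p *m adj b = 1%:M ->
  c *m Jmx p *m adj c = 1%:M -> b *m Jmx p *m adj c \in unitmx.
Proof.
move=> /beta_Kmx hb /beta_Kmx hc; have := jmx_prod_unit hb hc.
by rewrite adjmxM -Kmx_conj_jmx !mulmxA.
Qed.

(** The factors after [n] are absorbed into [G], so [intertwiner] applies to every truncation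
    [n <= N] with the same [psi]. *)
Lemma tailprod_split p N n (beta : nat -> 'M[C]_(p, p + p)) G z : (n <= N)%N ->
  tailprod N beta G 0 z = tailprod n beta (tailprod N beta G n.+1 z) 0 z.
Proof. by move=> nN; rewrite /tailprod (big_cat_nat (n := n.+1)) //= mulmxA. Qed.

Lemma posdef_gram n (X : 'M[C]_n) : X \in unitmx -> posdef (X *m adj X).
Proof.
move=> uX; split; first by rewrite adjmxM adjmxK.
move=> v v0; have -> : adj v *m (X *m adj X) *m v = adj (adj X *m v) *m (adj X *m v).
  by rewrite adjmxM adjmxK !mulmxA.
rewrite lt_def gram_ge0 andbT; apply: contra v0 => /eqP/gram_eq0 e.
by rewrite -[v]mul1mx -(mulVmx (_ : adj X \in unitmx)) ?adj_unit // -mulmxA e mulmx0.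
Qed.

(** [S0 = X adj X] with [X] from [intertwiner]. Allowing every [n <= N] gives all partial Gram sums,
    from which the single terms are recovered. *)
Lemma sylvester_factor p N n (beta : nat -> 'M[C]_(p, p + p)) (Rf Qf : C -> 'M[C]_p)
    (alpha : nat -> 'M[C]_p) : (n <= N)%N -> admissible N beta Rf Qf ->
  powser_expansion 0 alpha (fz beta N Rf Qf) ->
  exists S0 : 'M[C]_(\sum_(k < n.+1) p), [/\ forall S,
      Amx p n *m S - S *m adj (Amx p n) =
        'i *: (Pimx n alpha *m Jmx p *m adj (Pimx n alpha)) <-> S = S0,
    posdef S0 &
    adj (Pimx n alpha) *m invmx S0 *m Pimx n alpha = adj (Bmx n beta) *m Bmx n beta].
Proof.
move=> nN Hadm Hal; have [hbeta _ _ _] := Hadm.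
have [_ [G [B0 [HG HGz]]]] := fz_factor Hadm.
have hbeta_n k : (k <= n)%N -> beta k *m Jmx p *m adj (beta k) = 1%:M.
  by move=> kn; rewrite hbeta // (leq_trans kn).
have hunit k : (k < n)%N -> beta k.+1 *m Jmx p *m adj (beta k) \in unitmx.
  by move=> kn; apply: beta_J_beta_unit; rewrite hbeta_n // ltnW.
have HG' : holomx (fun z => tailprod N beta (G z) n.+1 z).
  by apply: holomxM HG; apply: holomx_prod => i; apply: holomx_Efac.
have [X [uX XL XB]] := intertwiner hbeta_n hunit
  (fun z hz => etrans (esym (tailprod_split beta (G z) z nN)) (HGz z hz)) HG' (powser_expands Hal).
(* Moving [L0] through [X] turns the left side into [i X (1 + L + adj L) adj X]; by [Lbeta_adj] the
   middle factor is [B J adj B], and [X B = Pi]. *)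
have eqS : Amx p n *m (X *m adj X) - X *m adj X *m adj (Amx p n) =
    'i *: (Pimx n alpha *m Jmx p *m adj (Pimx n alpha)).
  rewrite sylvester_hom -XB adjmxM; congr (_ *: _).
  rewrite !mulmxA -XL -(mulmxA X (adj X)) -adjmxM -XL adjmxM.
  rewrite -!mulmxA -!mulmxDr !mulmxA -(mulmxA X).
  by rewrite -[adj X in X in X + _ + _]mul1mx -!mulmxDl Lbeta_adj // !mulmxA.
exists (X *m adj X); split.
- move=> S; split=> [hS|-> //].
  apply/eqP; rewrite -subr_eq0; apply/eqP; apply: sylvester_uniq.
  have /eqP : Amx p n *m (S - X *m adj X) - (S - X *m adj X) *m adj (Amx p n) = 0.
    rewrite mulmxBr mulmxBl opprB addrACA [X in _ + X]addrC addrACA.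
    by rewrite hS -[X in _ + X]opprB eqS subrr.
  by rewrite sylvester_hom scaler_eq0 (negPf (neq0Ci _)) => /eqP.
- exact: posdef_gram.
- have uX' : adj X \in unitmx by rewrite adj_unit.
  have uXX : X *m adj X \in unitmx by rewrite unitmx_mul uX.
  have -> : invmx (X *m adj X) = invmx (adj X) *m invmx X.
    rewrite -[RHS]mul1mx -(mulVmx uXX) -!mulmxA (mulmxA (adj X)) mulmxV // mul1mx.
    by rewrite mulmxV // mulmx1.
  rewrite -XB adjmxM !mulmxA -(mulmxA _ (adj X)) mulmxV // mulmx1.
  by rewrite -(mulmxA _ (invmx X)) mulVmx // mulmx1.
Qed.
End WeylFunction.

Theorem theorem5p3 (R : realType) (p N : nat)
    (beta : nat -> 'M[R[i]]_(p, p + p)) (Rf Qf : R[i] -> 'M[R[i]]_p) :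
  (0 < p)%N ->
  admissible N beta Rf Qf ->
  [/\ (* properties of C_k *)
      forall k, (k <= N)%N ->
        [/\ adj (Cmx beta k) = Cmx beta k,
            Cmx beta k *m jmx p *m Cmx beta k = jmx p &
            posdef (Cmx beta k)],
      (* nondegeneracy of consecutive beta's *)
      forall k, (k < N)%N -> \det (beta k *m Jmx p *m adj (beta k.+1)) != 0,
      (* i phi(i(z+1)/(z-1)) has a Taylor expansion at z = 0 *)
      exists alpha : nat -> 'M[R[i]]_p, powser_expansion 0 alpha (fz beta N Rf Qf),
      (* C_0..C_N are determined by the first N+1 Taylor coefficients *)
      forall (beta' : nat -> 'M[R[i]]_(p, p + p)) (Rf' Qf' : R[i] -> 'M[R[i]]_p)
             (alpha alpha' : nat -> 'M[R[i]]_p),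
        admissible N beta' Rf' Qf' ->
        powser_expansion 0 alpha (fz beta N Rf Qf) ->
        powser_expansion 0 alpha' (fz beta' N Rf' Qf') ->
        (forall k, (k <= N)%N -> alpha k = alpha' k) ->
        forall k, (k <= N)%N -> Cmx beta' k = Cmx beta k &
      (* ... and explicitly as follows *)
      forall alpha : nat -> 'M[R[i]]_p,
        powser_expansion 0 alpha (fz beta N Rf Qf) ->
        (exists! S : 'M[R[i]]_(\sum_(k < N.+1) p),
            Amx p N *m S - S *m adj (Amx p N)
              = 'i *: (Pimx N alpha *m Jmx p *m adj (Pimx N alpha))) /\
        (forall S : 'M[R[i]]_(\sum_(k < N.+1) p),
            Amx p N *m S - S *m adj (Amx p N)
              = 'i *: (Pimx N alpha *m Jmx p *m adj (Pimx N alpha)) ->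
            [/\ posdef S,
                adj (Pimx N alpha) *m invmx S *m Pimx N alpha
                  = adj (Bmx N beta) *m Bmx N beta &
                adj (Bmx N beta) *m Bmx N beta
                  = \sum_(k < N.+1) adj (beta k) *m beta k])].
Proof.
move=> _ Hadm; have [hbeta _ _ _] := Hadm; split.
- by move=> k kN; apply/Cmx_props/hbeta.
- move=> k kN; rewrite -unitfE -unitmxE; apply: beta_J_beta_unit; apply: hbeta => //.
  exact: ltnW.
- by apply: holomx_powser; have [] := fz_factor Hadm.
- move=> beta' Rf' Qf' al al' Hadm' Hal Hal' eal k kN.
  (* [Pimx n] involves only coefficients up to [n], so both data sets have the same [S] and hence
     the same Gram sum. *)
  have gram n : (n <= N)%N -> \sum_(k < n.+1) adj (beta k) *m beta k =
      \sum_(k < n.+1) adj (beta' k) *m beta' k.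
    move=> nN.
    have [S [HS _ eS]] := sylvester_factor nN Hadm Hal.
    have [S' [HS' _ eS']] := sylvester_factor nN Hadm' Hal'.
    have ePi : Pimx n al = Pimx n al'.
      congr row_mx; apply/eq_mxcolP => l; apply: eq_bigr => r rl.
      by rewrite eal // (leq_trans rl) // (leq_trans (ltnSE (ltn_ord l))).
    have eSS : S = S' by apply/HS'; rewrite -ePi; apply/HS.
    by rewrite -!Bmx_gram -eS -eS' ePi eSS.
  (* [C_k] depends on [beta k] only through this product, which is the difference of two consecutive
     Gram sums. *)
  suff egram : adj (beta' k) *m beta' k = adj (beta k) *m beta k.
    by rewrite /Cmx -!mulmxA (mulmxA (adj (beta' k))) egram !mulmxA.
  have := gram k kN; rewrite !big_ord_recr /=; case: k kN => [|k] kN.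
    by rewrite !big_ord0 !add0r.
  by rewrite (gram k (ltnW kN)) => /addrI.
- move=> al Hal; have [S0 [HS0 pS0 eS0]] := sylvester_factor (leqnn N) Hadm Hal.
  split.
    exists S0; split; first exact/HS0.
    by move=> S /HS0.
  by move=> S /HS0 ->; rewrite -Bmx_gram.
Qed.
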